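(* Let $\mathcal H_{\rm in}$ and $\mathcal H$ be finite-dimensional Hilbert spaces, $d=\dim\mathcal H$, and let $m\ge1$. For every quantum operation $\mathscr C_m$ with input in $\mathcal H_{\rm in}$ and permutationally invariant output in $\mathcal H^{\otimes m}$ there exists a probabilistic-metrology (PM) protocol, described by a quantum operation $\widetilde{\mathscr C}_m$ from $\mathcal H_{\rm in}$ to $\mathcal H^{\otimes m}$, such that: (i) $\mathscr C_m$ and $\widetilde{\mathscr C}_m$ have the same success probability, i.e. $\mathrm{tr}[\widetilde{\mathscr C}_m(\rho)]=\mathrm{tr}[\mathscr C_m(\rho)]$ for every state $\rho$ on $\mathcal H_{\rm in}$; (ii) for every $1\le k\le m$ and every state $\rho$ on $\mathcal H_{\rm in}$ with $P_{\rm succ}(\rho):=\mathrm{tr}[\mathscr C_m(\rho)]>0$, the error probability $p_{\rm err}$ in distinguishing between $\mathscr C_m$ and $\widetilde{\mathscr C}_m$ by inputting the state $\rho$ and measuring $k$ output systems is lower bounded as $$p_{\rm err}\ \ge\ \frac12-\frac{kd^2}{2m\,P_{\rm succ}(\rho)} .$$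
   Context: A quantum operation is a completely positive, trace non-increasing linear map; its success probability on input $\rho$ is the trace of the output. The output of $\mathscr C_m$ is permutationally invariant if $\mathscr U_\pi\circ\mathscr C_m=\mathscr C_m$ for every permutation $\pi$ of $\{1,\dots,m\}$, where $\mathscr U_\pi$ is the linear map on operators on $\mathcal H^{\otimes m}$ with $\mathscr U_\pi(\rho_1\otimes\cdots\otimes\rho_m)=\rho_{\pi(1)}\otimes\cdots\otimes\rho_{\pi(m)}$. A PM protocol is a probabilistic measure-and-prepare operation: a quantum operation of the form $\rho\mapsto\int\mathrm{tr}[M(dy)\rho]\,\sigma_y$, where $M$ is a positive-operator-valued measure on some outcome space with total mass $\int M(dy)\le I$ (the missing mass corresponding to the outcome ''failure'') and $\sigma_y$ are states on $\mathcal H^{\otimes m}$. The error probability $p_{\rm err}$ is the minimum error probability, over all two-outcome measurements, in discriminating, with equal prior probabilities, the two conditional states on $k$ output systems $$\frac{\mathrm{tr}_{m-k}[\mathscr C_m(\rho)]}{\mathrm{tr}[\mathscr C_m(\rho)]}\qquad\text{and}\qquad\frac{\mathrm{tr}_{m-k}[\widetilde{\mathscr C}_m(\rho)]}{\mathrm{tr}[\widetilde{\mathscr C}_m(\rho)]},$$ where $\mathrm{tr}_{m-k}$ is the partial trace over $m-k$ of the $m$ output systems. *)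

(* Defs.v *)
From HB Require Import structures.
From mathcomp Require Import all_boot all_order all_algebra all_fingroup.
From mathcomp Require Import complex mxtens.
From mathcomp Require Import all_classical all_reals all_analysis.

Set Implicit Arguments.
Unset Strict Implicit.
Unset Printing Implicit Defensive.

Import Order.TTheory GRing.Theory Num.Theory.
Import numFieldNormedType.Exports.

Local Open Scope sesquilinear_scope.
Local Open Scope classical_set_scope.
Local Open Scope ring_scope.

(* A finite-dimensional Hilbert space is taken to be C^n, with C = R[i], and   *)
(* an operator on it is its matrix in the standard basis. The order on R[i] is *)
(* partial: 0 <= z says that z is real and nonnegative.                        *)

Section States.
Context {R : realType} {n : nat}.

Definition psdmx (A : 'M[R[i]]_n) : Prop :=
  forall v : 'cV[R[i]]_n, 0 <= (v ^t* *m A *m v) 0 0.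

Definition density (rho : 'M[R[i]]_n) : Prop := psdmx rho /\ \tr rho = 1.

End States.

Section QuantumOperations.
Context {R : realType} {n p : nat}.
Implicit Type Phi : {linear 'M[R[i]]_n -> 'M[R[i]]_p}.

(* id_r (x) Phi on operators on C^r (x) C^n (see ampliation_tens): Phi is      *)
(* applied to each of the r x r blocks, which are n x n matrices.              *)
Definition ampliation Phi (r : nat) (X : 'M[R[i]]_(r * n)) : 'M[R[i]]_(r * p) :=
  \matrix_(i, j)
    Phi (\matrix_(a, b) X (mxtens_index ((mxtens_unindex i).1, a))
                          (mxtens_index ((mxtens_unindex j).1, b)))
        (mxtens_unindex i).2 (mxtens_unindex j).2.

Lemma ampliation_tens Phi (r : nat) (A : 'M[R[i]]_r) (B : 'M[R[i]]_n) :
  ampliation Phi (A *t B) = A *t Phi B.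
Proof.
apply/matrixP => i j; rewrite !mxE.
set i1 := (mxtens_unindex i).1; set j1 := (mxtens_unindex j).1.
rewrite (_ : (\matrix_(a, b) _) = A i1 j1 *: B).
  by rewrite linearZ mxE.
by apply/matrixP => a b; rewrite !mxE !mxtens_indexK.
Qed.

Definition completely_positive Phi : Prop :=
  forall (r : nat) (X : 'M[R[i]]_(r * n)), psdmx X -> psdmx (ampliation Phi X).

Definition trace_nonincreasing Phi : Prop :=
  forall X : 'M[R[i]]_n, psdmx X -> \tr (Phi X) <= \tr X.

Definition quantum_operation Phi : Prop :=
  completely_positive Phi /\ trace_nonincreasing Phi.

Definition success_prob Phi (rho : 'M[R[i]]_n) : R := complex.Re (\tr (Phi rho)).

End QuantumOperations.

(* The standard basis of (C^d)^{(x) m} is indexed by the functions from 'I_m   *)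
(* to 'I_d, enumerated by tindex and trank.                                    *)
Definition tdim (d m : nat) : nat := #|{ffun 'I_m -> 'I_d}|.

Definition tindex {d m : nat} (i : 'I_(tdim d m)) : {ffun 'I_m -> 'I_d} :=
  enum_val i.

Definition trank {d m : nat} (u : {ffun 'I_m -> 'I_d}) : 'I_(tdim d m) :=
  enum_rank u.

Lemma tindexK d m : cancel (@tindex d m) trank.
Proof. exact: enum_valK. Qed.

Lemma trankK d m : cancel (@trank d m) tindex.
Proof. exact: enum_rankK. Qed.

Section TensorPowers.
Context {R : realType} {d m : nat}.
Implicit Types (X : 'M[R[i]]_(tdim d m)) (rho : 'I_m -> 'M[R[i]]_d).

Definition tensor_op rho : 'M[R[i]]_(tdim d m) :=
  \matrix_(i, j) \prod_(l < m) rho l (tindex i l) (tindex j l).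

Definition permute_index (s : 'S_m) (i : 'I_(tdim d m)) : 'I_(tdim d m) :=
  trank [ffun l => tindex i ((s^-1)%g l)].

Definition permute_op (s : 'S_m) X : 'M[R[i]]_(tdim d m) :=
  \matrix_(i, j) X (permute_index s i) (permute_index s j).

Lemma permute_op_is_linear (s : 'S_m) : linear (permute_op s).
Proof. by move=> a X Y; apply/matrixP => i j; rewrite !mxE. Qed.

Lemma permute_op_tensor (s : 'S_m) rho :
  permute_op s (tensor_op rho) = tensor_op (rho \o s).
Proof.
apply/matrixP => i j; rewrite !mxE /permute_index.
rewrite (reindex_inj (@perm_inj _ s)) /=; apply: eq_bigr => l _.
by rewrite !trankK !ffunE permK.
Qed.

(* Partial trace keeping the k systems f 0, ..., f k.-1 (f is meant to be      *)
(* injective), in this order, and tracing out the remaining ones.              *)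
Definition ptrace (k : nat) (f : 'I_k -> 'I_m) X : 'M[R[i]]_(tdim d k) :=
  \matrix_(i, j)
    \sum_(u : {ffun 'I_m -> 'I_d} | [forall a, u (f a) == tindex i a])
    \sum_(v : {ffun 'I_m -> 'I_d} |
            [forall a, v (f a) == tindex j a]
            && [forall l, (l \notin codom f) ==> (u l == v l)])
      X (trank u) (trank v).

End TensorPowers.

Lemma ptrace_tensor (R : realType) (d m k : nat) (f : 'I_k -> 'I_m)
    (rho : 'I_m -> 'M[R[i]]_d) :
  injective f ->
  ptrace f (tensor_op rho) =
  (\prod_(l | l \notin codom f) \tr (rho l)) *: tensor_op (rho \o f).
Proof.
move=> f_inj; apply/matrixP => i j; rewrite !mxE.
pose Q (l : 'I_m) (ab : 'I_d * 'I_d) :=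
  [forall a, (f a == l) ==> ((ab.1 == tindex i a) && (ab.2 == tindex j a))]
  && ((l \notin codom f) ==> (ab.1 == ab.2)).
transitivity (\prod_l \sum_(ab | Q l ab) rho l ab.1 ab.2).
  rewrite bigA_distr_big_dep pair_big_dep /=.
  rewrite (reindex (fun w : {ffun 'I_m -> 'I_d * 'I_d} =>
    ([ffun l => (w l).1], [ffun l => (w l).2]))) /=; last first.
    exists (fun uv : {ffun 'I_m -> 'I_d} * {ffun 'I_m -> 'I_d} => [ffun l => (uv.1 l, uv.2 l)]) => [w _|[u v] _].
      by apply/ffunP => l; rewrite !ffunE; case: (w l).
    by congr pair; apply/ffunP => l; rewrite !ffunE.
  apply: eq_big => [w|w _]; last first.
    by rewrite mxE; apply: eq_bigr => l _; rewrite !trankK !ffunE.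
  apply/and3P/familyP => [[/forallP u1 /forallP v1 /forallP uv] l|wQ].
    rewrite unfold_in; apply/andP; split; last by have := uv l; rewrite !ffunE.
    apply/forallP => a; apply/implyP => /eqP <-.
    by move: (u1 a) (v1 a); rewrite !ffunE => -> ->.
  split; apply/forallP => a; have := wQ _ => /(_ _); rewrite !ffunE.
  - by move=> /(_ (f a))/andP[/forallP/(_ a)]; rewrite eqxx => /andP[].
  - by move=> /(_ (f a))/andP[/forallP/(_ a)]; rewrite eqxx => /andP[].
  - by move=> /(_ a)/andP[].
rewrite (bigID (mem (codom f))) /= mulrC; congr (_ * _).
  apply: eq_bigr => l lf; rewrite /mxtrace.
  rewrite (reindex_onto (fun a : 'I_d => (a, a)) fst) /=; last first.
    by move=> [a b] /andP[_]; rewrite lf => /eqP /= ->.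
  apply: eq_bigl => a; rewrite /Q /= !eqxx implybT !andbT.
  by apply/forallP => c; apply/implyP => /eqP fc; rewrite -fc codom_f in lf.
have f_uniq : uniq (codom f) by rewrite /codom /image_mem map_inj_uniq ?enum_uniq.
rewrite -(@big_uniq _ _ _ _ _ (fun l => \sum_(ab | Q l ab) rho l ab.1 ab.2) f_uniq).
rewrite big_image /=; apply: eq_bigr => a _.
rewrite (big_pred1 (tindex i a, tindex j a)) // => -[x y].
rewrite /Q codom_f /= andbT; apply/forallP/eqP => [/(_ a)|[-> ->] c].
  by rewrite eqxx => /andP[/eqP -> /eqP ->].
by apply/implyP => /eqP/f_inj ->; rewrite !eqxx.
Qed.

Section OutputOperations.
Context {R : realType} {n d m : nat}.
Implicit Type Phi : {linear 'M[R[i]]_n -> 'M[R[i]]_(tdim d m)}.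

Definition perm_invariant_output Phi : Prop :=
  forall (s : 'S_m) (X : 'M[R[i]]_n), permute_op s (Phi X) = Phi X.

Definition conditional_state (k : nat) (f : 'I_k -> 'I_m) Phi
    (rho : 'M[R[i]]_n) : 'M[R[i]]_(tdim d k) :=
  (\tr (Phi rho))^-1 *: ptrace f (Phi rho).

End OutputOperations.

Section MeasureAndPrepare.
Context {R : realType} {n : nat} {disp : measure_display}.
Context {Y : measurableType disp}.

Definition outcome_measure (M : set Y -> 'M[R[i]]_n) (rho : 'M[R[i]]_n)
    (A : set Y) : \bar R :=
  (complex.Re (\tr (M A *m rho)))%:E.

(* Countable additivity is in the weak sense. The values of M on               *)
(* nonmeasurable sets are irrelevant.                                          *)
Definition povm (M : set Y -> 'M[R[i]]_n) : Prop :=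
  (forall A, measurable A -> psdmx (M A)) /\
  (forall rho, psdmx rho -> semi_sigma_additive (outcome_measure M rho)).

(* The integral over D of sigma y against tr[M(dy) rho], entry by entry.       *)
Definition measure_prepare (p : nat) (D : set Y) (M : set Y -> 'M[R[i]]_n)
    (sigma : Y -> 'M[R[i]]_p) (rho : 'M[R[i]]_n) : 'M[R[i]]_p :=
  \matrix_(i, j) Complex
    (fine (\int[outcome_measure M rho]_(y in D)
             (complex.Re (sigma y i j))%:E)%E)
    (fine (\int[outcome_measure M rho]_(y in D)
             (complex.Im (sigma y i j))%:E)%E).

End MeasureAndPrepare.

(* The outcome space is a measurable subset D of Y, rather than Y itself,      *)
(* because a measurableType is pointed, which would exclude the empty outcome  *)
(* space (needed when C^p = 0, where no state exists). Fixing Phi on states    *)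
(* fixes it everywhere, since Phi is linear and states span the operators.     *)
Definition pm_protocol {R : realType} {n p : nat}
    (Phi : {linear 'M[R[i]]_n -> 'M[R[i]]_p}) : Prop :=
  quantum_operation Phi /\
  exists (disp : measure_display) (Y : measurableType disp) (D : set Y)
         (M : set Y -> 'M[R[i]]_n) (sigma : Y -> 'M[R[i]]_p),
    [/\ measurable D,
        povm M /\ psdmx (1%:M - M D),
        (forall y, D y -> density (sigma y)),
        (forall i j,
           measurable_fun D (fun y => complex.Re (sigma y i j)) /\
           measurable_fun D (fun y => complex.Im (sigma y i j))) &
        forall rho, density rho -> Phi rho = measure_prepare D M sigma rho].

(* Minimum error probability in discriminating the equiprobable states rho0    *)
(* and rho1 by a two-outcome measurement {E0, E1}; the infimum is attained by  *)
(* compactness.                                                                *)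
Definition min_error_prob {R : realType} {p : nat}
    (rho0 rho1 : 'M[R[i]]_p) : R :=
  inf [set e : R | exists E0 E1 : 'M[R[i]]_p,
         [/\ psdmx E0, psdmx E1, E0 + E1 = 1%:M &
             e = 2^-1 * complex.Re (\tr (E1 *m rho0)) +
                 2^-1 * complex.Re (\tr (E0 *m rho1))]].

(* p_err for discriminating Phi from Psi with input rho and the k output       *)
(* systems f 0, ..., f k.-1.                                                   *)
Definition p_err {R : realType} {n d m k : nat} (f : 'I_k -> 'I_m)
    (Phi Psi : {linear 'M[R[i]]_n -> 'M[R[i]]_(tdim d m)})
    (rho : 'M[R[i]]_n) : R :=
  min_error_prob (conditional_state f Phi rho) (conditional_state f Psi rho).

(* Main.v *)
(* A permutation-invariant output is purified into the symmetric subspace: the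
   Choi matrix of C commutes with the permutations, hence so does its square
   root, whose columns, read as tensors over D = d^2 levels (system and
   purifying partner), are symmetric. The protocol measures all m purified
   systems with a finite coherent-state POVM (weighted vectors z^{(x) m} having
   the moments of a complex Gaussian vector up to degree m) and prepares
   |z><z|^{(x) m}, the partners being traced out.

   The k-system output T_k of the protocol dominates p R_k, where R_k is the
   k-system output of C and p = binom(m-k+D-1, D-1) / binom(m+D-1, D-1). For a
   symmetric tensor chi and a k-system vector q put r = <q|chi>. The two
   functions f(z) = <z^m|chi> <q|z^k> and g(z) = <z^{m-k}|r> have inner product
   proportional to |r|^2, so Cauchy-Schwarz bounds the norm of f, that is
   <q|T_k|q>, below by p |r|^2 = p <q|R_k|q>. Since p >= 1 - kD/m, any
   two-outcome measurement errs with probability at least p/2. *)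
Require Import Defs.
From HB Require Import structures.
From mathcomp Require Import all_boot all_order all_algebra all_fingroup.
From mathcomp Require Import cyclic separable cyclotomic.
From mathcomp Require Import complex mxtens ring lra zify.
From mathcomp Require Import all_classical all_reals all_analysis.
Set Implicit Arguments.
Unset Strict Implicit.
Unset Printing Implicit Defensive.
Import Order.TTheory GRing.Theory Num.Theory.
Import numFieldNormedType.Exports.
Local Open Scope ring_scope.
Local Open Scope sesquilinear_scope.

(** * Positive semidefinite matrices *)

Section PositiveMatrices.
Context {C : numClosedFieldType}.

Lemma quad_formE n (A : 'M[C]_n) (v : 'cV[C]_n) :
  (v ^t* *m A *m v) 0 0 = \sum_i \sum_j (v i 0)^* * A i j * v j 0.
Proof.
rewrite mxE exchange_big; apply: eq_bigr => i _ /=; rewrite mxE mulr_suml.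
by apply: eq_bigr => j _; rewrite !mxE.
Qed.

Lemma quad_form_delta n (A : 'M[C]_n) (i j : 'I_n) (c : C) :
  let v : 'cV[C]_n := delta_mx i 0 + c *: delta_mx j 0 in
  (v ^t* *m A *m v) 0 0 = A i i + c * A i j + c^* * A j i + c^* * c * A j j.
Proof.
have rowE (k : 'I_n) (B : 'cV[C]_n) : ((delta_mx k 0 : 'cV[C]_n)^T *m B) 0 0 = B k 0.
  by rewrite trmx_delta -rowE mxE.
move=> v; have vE : v ^t* = (delta_mx i 0)^T + c^* *: (delta_mx j 0)^T.
  by apply/matrixP => a b; rewrite !mxE !rmorphD rmorphM /= !conjC_nat.
rewrite -mulmxA vE mulmxDl -scalemxAl mxE [X in _ + X]mxE !rowE.
by rewrite /v mulmxDr -scalemxAr -!colE !mxE; ring.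
Qed.

(** The form at [e_i + c e_j] is real; c = 1 and c = i give two equations that force [A j i] to be
    the conjugate of [A i j]. The spectral theorem, which wants a normal matrix, thus applies. *)
Lemma quad_form_ge0_herm n (A : 'M[C]_n) :
  (forall v : 'cV[C]_n, 0 <= (v ^t* *m A *m v) 0 0) -> A ^t* = A.
Proof.
move=> A_ge0; have real c i j : c * A i j + c^* * A j i =
    (c * A i j + c^* * A j i)^*.
  have Aii k : A k k \is Num.real.
    have := A_ge0 (delta_mx k 0 + 0 *: delta_mx k 0).
    by rewrite quad_form_delta !(rmorph0, mul0r, addr0) => /ger0_real.
  have := A_ge0 (delta_mx i 0 + c *: delta_mx j 0).
  rewrite quad_form_delta => /ger0_real/CrealP.
  have cc : (c^* * c) \is Num.real by rewrite mulrC -normCK rpredX ?normr_real.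
  have /CrealP := Aii i; have /CrealP := rpredM cc (Aii j).
  rewrite -!addrA; set u := c * _; set w := c^* * A j i; set x := c^* * c * _.
  by rewrite !rmorphD /= => -> -> /addrI; rewrite !addrA => /addIr /esym.
apply/matrixP => i j; rewrite !mxE.
have e1 := real 1 j i; have e2 := real 'i j i.
rewrite rmorphD !rmorphM /= conjCK in e1.
rewrite rmorphD !rmorphM /= conjCK conjCi in e2.
rewrite !rmorph1 !mul1r in e1.
have e3 : A j i - A i j = (A i j)^* - (A j i)^*.
  by apply: (mulfI (neq0Ci C)); rewrite !mulrBr -!mulNr e2; ring.
apply: (mulIf (_ : 2%:R != 0 :> C)); first by rewrite pnatr_eq0.
have : (A j i)^* *+ 2 = A i j *+ 2.
  have -> : (A j i)^* *+ 2 = (A j i)^* + (A i j)^* - ((A i j)^* - (A j i)^*) by ring.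
  by rewrite -e3 -e1; ring.
by rewrite !mulr_natr.
Qed.

Lemma psd_spectral n (A : 'M[C]_n) :
  (forall v : 'cV[C]_n, 0 <= (v ^t* *m A *m v) 0 0) ->
  exists (P : 'M[C]_n) (D : 'rV[C]_n),
    [/\ P \is unitarymx, forall j, 0 <= D 0 j & A = P ^t* *m diag_mx D *m P].
Proof.
move=> A_ge0; have A_herm := quad_form_ge0_herm A_ge0.
have A_normal : A \is normalmx by apply/normalmxP; rewrite A_herm.
have P_unitary := spectral_unitarymx A.
have /orthomx_spectralP A_eq := A_normal.
rewrite invmx_unitary // in A_eq.
exists (spectralmx A), (spectral_diag A); split=> // j.
have := A_ge0 ((spectralmx A) ^t* *m delta_mx j 0).
rewrite {2}A_eq trmx_mul map_mxM trmxCK !mulmxA.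
rewrite mulmxtVK // mulmxtVK // trmx_delta map_delta_mx.
by rewrite -rowE -colE !mxE eqxx mulr1n.
Qed.

(** Square roots of the eigenvalues are taken in an eigenbasis. The commutation clause later carries
    permutation symmetry from the Choi matrix over to its root. *)
Lemma psd_sqrt n (A : 'M[C]_n) :
  (forall v : 'cV[C]_n, 0 <= (v ^t* *m A *m v) 0 0) ->
  exists2 S : 'M[C]_n, S *m S ^t* = A & forall U, comm_mx U A -> comm_mx U S.
Proof.
move=> /psd_spectral[P [D [P_unitary D_ge0 A_eq]]].
pose sD := \row_j sqrtC (D 0 j).
have sD_real : diag_mx sD ^t* = diag_mx sD.
  rewrite tr_diag_mx map_diag_mx; congr diag_mx; apply/rowP => j; rewrite !mxE.
  by apply/CrealP; rewrite ger0_real // sqrtC_ge0.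
have PP : P *m P ^t* = 1%:M by apply/unitarymxP.
have PtP : P ^t* *m P = 1%:M by apply/mulmx1C.
exists (P ^t* *m diag_mx sD *m P) => [|U].
  rewrite !trmx_mul !map_mxM /= sD_real trmxCK !mulmxA mulmxtVK // A_eq.
  congr (_ *m _); rewrite -mulmxA; congr (_ *m _).
  rewrite mulmx_diag; congr diag_mx; apply/rowP => j.
  by rewrite !mxE -expr2 sqrtCK.
have conj_comm E : comm_mx U (P ^t* *m diag_mx E *m P) <->
    comm_mx (P *m U *m P ^t*) (diag_mx E).
  rewrite /comm_mx; split=> e.
    have := congr1 (fun X => P *m X *m P ^t*) e; rewrite !mulmxA.
    by rewrite !mulmxtVK // PP mul1mx => ->.
  have := congr1 (fun X => P ^t* *m X *m P) e; rewrite !mulmxA PtP mul1mx.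
  by rewrite -(mulmxA _ (P^t*) P) PtP mulmx1 => ->.
rewrite A_eq => /conj_comm e; apply/conj_comm.
move/matrixP: e => e; apply/matrixP => i j; have := e i j.
(* In the eigenbasis, an entry of a commuting matrix either vanishes or joins equal eigenvalues,
   hence equal roots. *)
rewrite !mul_mx_diag !mul_diag_mx !mxE => /eqP.
rewrite [D 0 i * _]mulrC -subr_eq0 -mulrBr mulf_eq0 => /orP[/eqP->|].
  by rewrite mul0r mulr0.
by rewrite subr_eq0 => /eqP->; rewrite mulrC.
Qed.

End PositiveMatrices.

(** * Finite designs with Gaussian moments *)

Section Designs.
Context {C : numClosedFieldType}.

(* Gauss-Laguerre quadrature: J is the truncated Jacobi matrix of the Laguerre
   polynomials, up to signs, and x a = J^a e_0, so that lam consists of the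
   eigenvalues of J and nu of the squared moduli of the components of e_0. *)
Lemma factorial_moments (N : nat) :
  exists (nu lam : 'I_N.+1 -> C),
    [/\ forall j, 0 <= nu j, forall j, 0 <= lam j &
        forall a, (a <= N)%N -> \sum_j nu j * lam j ^+ a = (a`!)%:R].
Proof.
pose U : 'M[C]_N.+1 := \matrix_(k, i) ((i == k :> nat) + (i == k.+1 :> nat))%:R.
pose E : 'rV[C]_N.+1 := \row_k (k.+1)%:R.
pose J := U^T *m diag_mx E *m U.
pose x a : 'cV[C]_N.+1 := \col_k (a`! * 'C(a, k))%:R.
have Ux a k : (a <= N)%N -> (U *m x a) k 0 = (a`! * 'C(a.+1, k.+1))%:R.
  move=> aN; rewrite mxE.
  under eq_bigr do rewrite !mxE natrD mulrDl -!natrM.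
  rewrite big_split /= (bigD1 k) //= eqxx mul1n big1 ?addr0; last first.
    by move=> i /negPf ik; rewrite (_ : (i == k :> nat) = false).
  rewrite binS mulnDr natrD addrC; congr (_ + _).
  have [kN|Nk] := ltnP k.+1 N.+1.
    rewrite (bigD1 (Ordinal kN)) //= eqxx mul1n big1 ?addr0 //.
    move=> i ik; rewrite (_ : (i == k.+1 :> nat) = false) //.
    by apply: contraNF ik => /eqP e; apply/eqP/val_inj.
  (* In the last row the truncation drops the binomial of [a] over N + 1, which is 0 because a <=
     N. *)
  rewrite bin_small ?muln0 ?big1 // => [i _|].
    by rewrite ltn_eqF ?mul0n // (leq_trans (ltn_ord i)).
  by rewrite (leq_trans _ Nk).
have Jx a : (a <= N)%N -> J *m x a = x a.+1.
  move=> aN; apply/colP => i; rewrite /J -!mulmxA mxE.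
  under eq_bigr => k _.
    rewrite mul_diag_mx [(\matrix_(_, _) _) k 0]mxE Ux // !mxE -natrM.
    rewrite mulnCA -mul_bin_diag mulnA [(a`! * _)%N]mulnC -factS.
    rewrite natrD mulrDl -!natrM.
    over.
  rewrite big_split /= !mxE (bigD1 i) //= eqxx mul1n big1 ?addr0; last first.
    by move=> k /negPf ki; rewrite eq_sym (_ : (k == i :> nat) = false).
  case: i => -[|i] iN /=; first by rewrite !bin0 big1 ?addr0.
  rewrite binS mulnDr natrD; congr (_ + _).
  rewrite (bigD1 (Ordinal (ltnW iN))) //= eqxx mul1n big1 ?addr0 // => k ki.
  rewrite (_ : (i.+1 == k.+1) = false) // eqSS.
  by apply: contraNF ki => /eqP e; apply/eqP/val_inj.
have [|P [D [P_unitary D_ge0 J_eq]]] := @psd_spectral C _ J.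
  move=> v; have Ut : U^T = U ^t* by apply/matrixP => i j; rewrite !mxE conjC_nat.
  have -> : v ^t* *m J *m v = (U *m v) ^t* *m diag_mx E *m (U *m v).
    by rewrite /J Ut trmx_mul map_mxM !mulmxA.
  rewrite mul_mx_diag mxE; apply: sumr_ge0 => k _; rewrite !mxE.
  by rewrite mulrAC mulr_ge0 ?ler0n // mulrC mul_conjC_ge0.
pose y a := P *m x a.
have yE a j : (a <= N)%N -> y a j 0 = D 0 j ^+ a * y 0%N j 0.
  elim: a => [|a IHa] aN; first by rewrite expr0 mul1r.
  rewrite /y -Jx ?(ltnW aN) // J_eq !mulmxA (unitarymxP P_unitary) mul1mx.
  by rewrite -mulmxA mul_diag_mx mxE IHa ?(ltnW aN) // exprS mulrA.
exists (fun j => (y 0%N j 0)^* * y 0%N j 0), (fun j => D 0 j).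
split=> // [j|a aN]; first by rewrite mulrC mul_conjC_ge0.
(* The moment is the inner product of [x 0] with [x a], computed in the eigenbasis; [x 0] is the
   first basis vector and [x a] has first entry a!. *)
transitivity (((y 0%N) ^t* *m y a) 0 0).
  rewrite mxE; apply: eq_bigr => j _; rewrite [in RHS]yE //.
  by rewrite [(_ ^t*) _ _]mxE [_^T _ _]mxE; ring.
have PtP : P ^t* *m P = 1%:M by apply/mulmx1C/unitarymxP.
rewrite /y trmx_mul map_mxM -mulmxA (mulmxA _ P) PtP mul1mx mxE.
rewrite (bigD1 0) //= !mxE big1 ?addr0 => [|k k0]; last first.
  by case: k k0 => -[|k] //= kN _; rewrite !mxE bin0n muln0 conjC0 mul0r.
by rewrite !bin0 !muln1 conjC_nat mul1r.
Qed.

Lemma prim_root_exists n : (n > 0)%N -> exists z : C, n.-primitive_root z.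
Proof.
pose p : {poly C} := 'X^n - 1; have [r Dp] := closed_field_poly_normal p.
move=> n_gt0; rewrite (monicP _) ?monicXnsubC // scale1r in Dp.
have rn1 : all n.-unity_root r by apply/allP => z; rewrite -root_prod_XsubC -Dp.
have sz_r : (n < (size r).+1)%N.
  by rewrite -(size_prod_XsubC r id) -Dp size_XnsubC.
have [|z] := hasP (has_prim_root n_gt0 rn1 _ sz_r); last by exists z.
by rewrite -separable_prod_XsubC -Dp separable_Xn_sub_1 // pnatr_eq0 -lt0n.
Qed.

(** A geometric sum: the conjugate of [w] is its inverse, so the ratio is w^(a-b), which is 1 only
    for a = b since both exponents are at most N. *)
Lemma sum_unity_root_conj N (w : C) a b : N.+1.-primitive_root w ->
  (a <= N)%N -> (b <= N)%N ->
  \sum_(e < N.+1) (w ^+ e) ^+ a * ((w ^+ e)^*) ^+ b = ((a == b) * N.+1)%:R.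
Proof.
move=> w_prim aN bN; have wN := prim_expr_order w_prim.
have w1 : `|w| = 1.
  apply/eqP; rewrite -(@pexpr_eq1 _ _ N.+1) // -normrX wN normr1 //.
pose t := w ^+ a * (w ^* ) ^+ b.
have wwc : w * w^* = 1 by rewrite -normCK w1 expr1n.
under eq_bigr => e _.
  rewrite rmorphXn /= -!exprM mulnC [(e * b)%N]mulnC !exprM -exprMn -/t.
  over.
have tN : t ^+ N.+1 = 1.
  by rewrite exprMn -!exprM mulnC exprM wN mulnC exprM -rmorphXn wN rmorph1 !expr1n mul1r.
have [ab|ab] := eqVneq a b.
  rewrite /t -ab -exprMn wwc expr1n mul1n.
  by under eq_bigr do rewrite expr1n; rewrite sumr_const card_ord.
have t1 : t - 1 != 0.
  rewrite subr_eq0; apply: contra_neq ab => t1.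
  have : w ^+ a == w ^+ b.
    by rewrite -[X in _ == X]mul1r -t1 /t -mulrA -exprMn mulrC [_^* * w]mulrC wwc expr1n mul1r.
  by rewrite (eq_prim_root_expr w_prim) !modn_small // => /eqP.
by apply: (mulfI t1); rewrite -subrX1 tN subrr mul0n mulr0.
Qed.

(** Polar coordinates: the squared modulus runs over quadrature nodes with factorial moments, and
    the phase over the roots of unity of order N + 1, which kill the moments with a different from
    b. *)
Lemma gaussian_atoms (N : nat) :
  exists (I : finType) (w z : I -> C), (forall i, 0 <= w i) /\
    forall a b, (a <= N)%N -> (b <= N)%N ->
      \sum_i w i * (z i ^+ a * (z i)^* ^+ b) = ((a == b) * a`!)%:R.
Proof.
have [nu [lam [nu_ge0 lam_ge0 nuE]]] := factorial_moments N.
have [w w_prim] := @prim_root_exists N.+1 isT.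
exists ('I_N.+1 * 'I_N.+1)%type, (fun i : 'I_N.+1 * 'I_N.+1 => nu i.1 / (N.+1)%:R),
  (fun i : 'I_N.+1 * 'I_N.+1 => sqrtC (lam i.1) * w ^+ i.2).
split=> [i|a b aN bN]; first by rewrite divr_ge0 ?ler0n.
rewrite -(pair_bigA _ (fun j (e : 'I_N.+1) => nu j / (N.+1)%:R *
  ((sqrtC (lam j) * w ^+ e) ^+ a * (sqrtC (lam j) * w ^+ e)^* ^+ b))) /=.
transitivity (\sum_j nu j / (N.+1)%:R * sqrtC (lam j) ^+ (a + b) *
                ((a == b) * N.+1)%:R).
  apply: eq_bigr => j _; rewrite -(sum_unity_root_conj w_prim aN bN) mulr_sumr.
  apply: eq_bigr => e _; rewrite rmorphM /= !exprMn exprD.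
  by rewrite [(sqrtC _)^*]conj_Creal ?ger0_real ?sqrtC_ge0 //; ring.
have N0 : (N.+1)%:R != 0 :> C by rewrite pnatr_eq0.
have [<-|ab] := eqVneq a b; last first.
  by rewrite !mul0n big1 // => j _; rewrite mulr0.
rewrite !mul1n -nuE //; apply: eq_bigr => j _.
by rewrite addnn -mul2n exprM sqrtCK mulrAC divfK.
Qed.

(** Independent atoms for the coordinates: the weights multiply and the moments factorise. *)
Lemma gaussian_design (K : finType) (N : nat) :
  exists (Y : finType) (w : Y -> C) (z : Y -> K -> C), (forall y, 0 <= w y) /\
    forall a b : K -> nat, (forall c, (a c <= N)%N) -> (forall c, (b c <= N)%N) ->
      \sum_y w y * (\prod_c z y c ^+ a c * \prod_c (z y c)^* ^+ b c) =
      \prod_c ((a c == b c) * (a c)`!)%:R.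
Proof.
have [I [w [z [w_ge0 wE]]]] := gaussian_atoms N.
exists {ffun K -> I}, (fun y : {ffun K -> I} => \prod_c w (y c)), (fun (y : {ffun K -> I}) c => z (y c)).
split=> [y|a b aN bN]; first exact: prodr_ge0.
under [RHS]eq_bigr => c _ do rewrite -(wE _ _ (aN c) (bN c)).
rewrite bigA_distr_bigA; apply: eq_bigr => y _.
by rewrite -!big_split.
Qed.

End Designs.

(** * Functions on words *)

Section SymmetricFunctions.
Context {K : finType}.

Lemma sum_eq_pred1 (c : K) : (\sum_c' (c == c'))%N = 1%N.
Proof.
rewrite (bigD1 c) //= eqxx big1 // => c' /negPf c'c.
by rewrite eq_sym c'c.
Qed.

Definition occ m (x : {ffun 'I_m -> K}) (c : K) : nat := \sum_(i < m) (x i == c).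

Lemma occ_sum m (x : {ffun 'I_m -> K}) : (\sum_c occ x c)%N = m.
Proof.
rewrite exchange_big /=; under eq_bigr => i _ do rewrite sum_eq_pred1.
by rewrite sum1_card card_ord.
Qed.

Lemma prod_occ (R : comPzRingType) m (x : {ffun 'I_m -> K}) (z : K -> R) :
  \prod_i z (x i) = \prod_c z c ^+ occ x c.
Proof.
rewrite /occ; under [RHS]eq_bigr do rewrite -prodrXr.
rewrite exchange_big; apply: eq_bigr => i _ /=.
rewrite (bigD1 (x i)) //= eqxx expr1 big1 ?mulr1 // => c /negPf xc.
by rewrite eq_sym xc expr0.
Qed.

Definition permutation_invariant (T : Type) m (p : {ffun 'I_m -> K} -> T) : Prop :=
  forall (s : 'S_m) (x : {ffun 'I_m -> K}), p [ffun i => x (s i)] = p x.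

(** Words with equal letter counts are rearrangements of each other. *)
Lemma permutation_invariant_occ (T : Type) m (p : {ffun 'I_m -> K} -> T) x x' :
  permutation_invariant p -> occ x =1 occ x' -> p x = p x'.
Proof.
move=> p_inv e.
have cnt (u : {ffun 'I_m -> K}) c : count_mem c [tuple u i | i < m] = occ u c.
  by rewrite count_map -sum1_count big_enum_cond big_mkcond; apply: eq_bigr => i _ /=; case: eqP.
have /tuple_permP[s Es] : perm_eq [tuple x i | i < m] [tuple x' i | i < m].
  by apply/allP => c _ /=; rewrite !cnt e.
rewrite -(p_inv s x'); congr p; apply/ffunP => i; rewrite ffunE.
have /val_inj/(congr1 (fun t => tnth t i)) := Es.
by rewrite !tnth_mktuple.
Qed.

(** The multinomial count of words with given letter counts, with the factorials multiplied through.
    Splitting off a first letter c contributes a factor [a c], and these factors add up to the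
    length. *)
Lemma sum_occ_fact (R : comNzRingType) m (a : K -> nat) :
  (\sum_c a c)%N = m ->
  \sum_(x : {ffun 'I_m -> K} | [forall c, occ x c == a c]) \prod_c (a c)`!%:R
    = m`!%:R :> R.
Proof.
elim: m a => [|m IHm] a a_sum.
  have a0 c : a c = 0%N.
    by apply/eqP; rewrite -leqn0 -a_sum (bigD1 c) //= leq_addr.
  have x0 : {ffun 'I_0 -> K} by apply: finfun => -[].
  rewrite (big_pred1 x0) => [|x]; first by rewrite big1 // => c _; rewrite a0.
  have -> : x = x0 by apply/ffunP => -[].
  by rewrite /= eqxx; apply/forallP => c; rewrite /occ big_ord0 a0.
pose cons (u : K * {ffun 'I_m -> K}) : {ffun 'I_m.+1 -> K} :=
  [ffun i => if unlift ord0 i is Some j then u.2 j else u.1].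
have occ_cons u c : occ (cons u) c = ((u.1 == c) + occ u.2 c)%N.
  rewrite /occ big_ord_recl ffunE unlift_none; congr (_ + _)%N.
  by apply: eq_bigr => i _; rewrite ffunE liftK.
rewrite (reindex cons) /=; last first.
  exists (fun x => (x ord0, [ffun i => x (lift ord0 i)])) => [[c t] _|x _].
    rewrite !ffunE unlift_none; congr pair; apply/ffunP => i.
    by rewrite !ffunE liftK.
  by apply/ffunP => i; rewrite ffunE; case: unliftP => [j|] -> //=; rewrite ffunE.
rewrite -(pair_big_dep xpredT (fun c t => [forall c', occ (cons (c, t)) c' == a c'])
  (fun _ _ => \prod_c (a c)`!%:R)) /=.
rewrite factS natrM -[in RHS]a_sum natr_sum mulr_suml; apply: eq_bigr => c _.
have [a0|a_gt0] := posnP (a c).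
  rewrite a0 mul0r big1 // => t /forallP/(_ c).
  by rewrite occ_cons eqxx a0.
(* The letter counts left after removing the first letter c; the truncated subtraction is exact
   because [a c] is positive. *)
pose b c' := (a c' - (c == c'))%N.
have a_b c' : a c' = ((c == c') + b c')%N.
  by rewrite subnKC //; case: eqP => // <-.
have b_sum : (\sum_c b c)%N = m.
  apply: succn_inj; rewrite -a_sum.
  under [RHS]eq_bigr do rewrite a_b.
  by rewrite big_split /= sum_eq_pred1.
rewrite -(IHm b b_sum) mulr_sumr; apply: eq_big => [t|t _].
  by apply: eq_forallb => c'; rewrite occ_cons a_b eqn_add2l.
rewrite (bigD1 c) //= [in RHS](bigD1 c) //= mulrA -natrM.
congr (_ * _); last first.
  by apply: eq_bigr => c' /negPf c'c; rewrite a_b eq_sym c'c.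
by have -> : a c = (b c).+1; [rewrite a_b eqxx | rewrite factS].
Qed.

End SymmetricFunctions.

(** * Words split into kept and discarded positions *)

Section Glue.
Context {K : finType} {k l m : nat}.
Variables (h : 'I_k + 'I_l -> 'I_m) (hV : 'I_m -> 'I_k + 'I_l).
Hypotheses (hK : cancel h hV) (hVK : cancel hV h).
Implicit Types (xi : {ffun 'I_k -> K}) (t : {ffun 'I_l -> K}).

Definition ffun_glue xi t : {ffun 'I_m -> K} :=
  [ffun i => match hV i with inl a => xi a | inr b => t b end].

Lemma ffun_glue_inl xi t a : ffun_glue xi t (h (inl a)) = xi a.
Proof. by rewrite ffunE hK. Qed.

Lemma ffun_glue_inr xi t b : ffun_glue xi t (h (inr b)) = t b.
Proof. by rewrite ffunE hK. Qed.

Lemma ffun_glueK (x : {ffun 'I_m -> K}) :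
  ffun_glue [ffun a => x (h (inl a))] [ffun b => x (h (inr b))] = x.
Proof.
by apply/ffunP => i; rewrite -[in RHS](hVK i) ffunE; case: (hV i) => a; rewrite ffunE.
Qed.

Lemma sum_glue (V : nmodType) (F : {ffun 'I_m -> K} -> V) :
  \sum_x F x = \sum_xi \sum_t F (ffun_glue xi t).
Proof.
rewrite pair_bigA /= (reindex (fun u => ffun_glue u.1 u.2)) //.
exists (fun x : {ffun 'I_m -> K} => ([ffun a => x (h (inl a))], [ffun b => x (h (inr b))])) => [[xi t] _|x _].
  by congr pair; apply/ffunP => i; rewrite ffunE ?ffun_glue_inl ?ffun_glue_inr.
exact: ffun_glueK.
Qed.

Lemma prod_glue (R : comPzRingType) (z : K -> R) xi t :
  \prod_i z (ffun_glue xi t i) = \prod_a z (xi a) * \prod_b z (t b).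
Proof.
rewrite (reindex h) /=; last by exists hV => ? _.
rewrite big_sumType /=.
by congr (_ * _); apply: eq_bigr => i _; rewrite ?ffun_glue_inl ?ffun_glue_inr.
Qed.

Lemma permutation_invariant_glue (T : Type) (p : {ffun 'I_m -> K} -> T) xi :
  permutation_invariant p -> permutation_invariant (fun t => p (ffun_glue xi t)).
Proof.
move=> p_inv s t.
(* The permutation [s] of the discarded positions, extended by the identity on the kept ones. *)
pose g i := h (match hV i with inl a => inl a | inr b => inr (s b) end).
have g_inj : injective g.
  move=> i j /(can_inj hK) e; apply: (can_inj hVK); move: e.
  by case: (hV i) (hV j) => a [] b // [] /perm_inj ->.
rewrite -[in RHS](p_inv (perm g_inj)); congr p; apply/ffunP => i.
by rewrite !ffunE permE /g hK; case: (hV i) => b //; rewrite ffunE.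
Qed.

End Glue.

(* With i = k this is the lower bound 1 - k D / (k + l) on the ratio of the
   dimensions of the symmetric subspaces for l and for k + l systems. *)
Lemma rising_factorial_bound k l D i : (k * D <= k + l)%N -> (i <= k)%N ->
  ((k + l - i * D) * (l`! * \prod_(j < i) (D + l + j)) <= (k + l) * (l + i)`!)%N.
Proof.
move=> kD; elim: i => [|i IHi] ik; first by rewrite big_ord0 addn0 muln1 subn0.
have {IHi} := IHi (ltnW ik); rewrite big_ord_recr /= [(l`! * (_ * _))%N]mulnA addnS factS.
set P := (l`! * \prod_(_ < i) _)%N => IHi.
have -> : ((k + l - i.+1 * D) * (P * (D + l + i)) =
  ((k + l - i.+1 * D) * (D + l + i)) * P)%N by nia.
(* Passing from i to i + 1 brings in D + l + i on the left and l + i + 1 on the right; the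
   hypothesis, read as k (D - 1) <= l, makes the prefactors compensate. *)
have step : ((k + l - i.+1 * D) * (D + l + i) <= (k + l - i * D) * (l + i).+1)%N.
  have iD : (i.+1 * D <= k + l)%N by nia.
  have [v Ev] : exists v, (k + l = v + i.+1 * D)%N by exists (k + l - i.+1 * D)%N; lia.
  rewrite Ev addnK (_ : (v + i.+1 * D - i * D = v + D)%N); last by rewrite mulSn; lia.
  suff : (v * D <= v + D * (l + i).+1)%N by nia.
  have e2 : (v * D + i.+1 * D * D = (k + l) * D)%N by rewrite Ev mulnDl.
  nia.
apply: leq_trans (leq_mul step (leqnn P)) _.
by rewrite mulnAC [X in (_ <= X)%N]mulnCA [X in (_ <= X)%N]mulnC leq_mul2r IHi orbT.
Qed.

(** * The coherent-state measurement *)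

Section CoherentStates.
Context {C : numClosedFieldType} {K Y : finType} (N : nat).
Variables (w : Y -> C) (z : Y -> K -> C).
Hypothesis w_ge0 : forall y, 0 <= w y.
Hypothesis design : forall a b : K -> nat,
  (forall c, (a c <= N)%N) -> (forall c, (b c <= N)%N) ->
  \sum_y w y * (\prod_c z y c ^+ a c * \prod_c (z y c)^* ^+ b c) =
  \prod_c ((a c == b c) * (a c)`!)%:R.

Definition norm2 y := \sum_c z y c * (z y c)^*.

(** An entry of the m-th tensor power of the vector [z y]; [overlap] is the inner product of that
    power with [p]. *)
Definition monomial m (y : Y) (x : {ffun 'I_m -> K}) := \prod_i z y (x i).

Definition overlap m (y : Y) (p : {ffun 'I_m -> K} -> C) :=
  \sum_x p x * (monomial y x)^*.

Lemma norm2_ge0 y : 0 <= norm2 y.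
Proof. by apply: sumr_ge0 => c _; apply: mul_conjC_ge0. Qed.

Lemma norm2_eq0 y c : norm2 y = 0 -> z y c = 0.
Proof.
move=> /eqP; rewrite psumr_eq0 => [/allP/(_ c)|c' _]; last exact: mul_conjC_ge0.
by rewrite mem_index_enum mul_conjC_eq0 => /(_ isT)/eqP.
Qed.

(** One factor [norm2 y] is the sum over c of |z_c|^2, and each summand raises both exponents at c
    by one. The factorials then gain [a c + 1], which sums over c to |K| plus the degree. *)
Lemma design_norm2 j a b : (\sum_c a c + j <= N)%N -> (\sum_c b c + j <= N)%N ->
  \sum_y w y * norm2 y ^+ j * (\prod_c z y c ^+ a c * \prod_c (z y c)^* ^+ b c) =
  (\prod_(i < j) (#|K| + \sum_c a c + i))%:R * \prod_c ((a c == b c) * (a c)`!)%:R.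
Proof.
have leS (e : K -> nat) c : (e c <= \sum_c e c)%N by rewrite (bigD1 c) //= leq_addr.
elim: j a b => [|j IHj] a b aN bN.
  rewrite big_ord0 mul1r -design => [|c|c].
  - by apply: eq_bigr => y _; rewrite expr0 mulr1.
  - by rewrite addn0 in aN; apply: leq_trans (leS a c) aN.
  - by rewrite addn0 in bN; apply: leq_trans (leS b c) bN.
pose up (e : K -> nat) c c' := (e c' + (c == c'))%N.
have up_sum e c : (\sum_c' up e c c')%N = (\sum_c' e c').+1.
  by rewrite big_split /= sum_eq_pred1 addn1.
have prod_up (u : K -> C) e c : \prod_c' u c' ^+ up e c c' = u c * \prod_c' u c' ^+ e c'.
  under eq_bigr do rewrite exprD.
  rewrite big_split /= mulrC; congr (_ * _).
  rewrite (bigD1 c) //= eqxx expr1 big1 ?mulr1 // => c' /negPf c'c.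
  by rewrite eq_sym c'c expr0.
transitivity (\sum_c \sum_y w y * norm2 y ^+ j *
    (\prod_c' z y c' ^+ up a c c' * \prod_c' (z y c')^* ^+ up b c c')).
  rewrite exchange_big /=; apply: eq_bigr => y _.
  rewrite exprSr {2}/norm2 [w y * (_ * _)]mulrA mulr_sumr mulr_suml; apply: eq_bigr => c _.
  by rewrite (prod_up (z y)) (prod_up (fun c => (z y c)^*)); ring.
under [LHS]eq_bigr => c _.
  rewrite (IHj (up a c) (up b c)) ?up_sum ?addSnnS //.
  have -> : \prod_c' ((up a c c' == up b c c') * (up a c c')`!)%:R =
    (a c).+1%:R * \prod_c' ((a c' == b c') * (a c')`!)%:R :> C.
    rewrite (bigD1 c) //= [in RHS](bigD1 c) //= mulrA -natrM.
    rewrite /up eqxx eqn_add2r addn1 factS; congr (_%:R * _); first by lia.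
    by apply: eq_bigr => c' /negPf c'c; rewrite [c == c']eq_sym c'c !addn0.
  over.
rewrite big_ord_recl /= addn0 -mulr_sumr -mulr_suml -natr_sum.
have -> : (\sum_c (a c).+1 = #|K| + \sum_c a c)%N.
  by rewrite -sum1_card -big_split.
rewrite mulrA -natrM; congr (_%:R * _).
rewrite mulnC; congr (_ * _)%N; apply: eq_bigr => i _.
by rewrite /bump /= addnS add1n addnS.
Qed.

(** For j = 0 this is the coherent-state resolution of the identity on symmetric tensors. Only words
    with the letter counts of x' survive, [p] is constant on them, and [sum_occ_fact] counts
    them. *)
Lemma overlap_reproducing j m (p : {ffun 'I_m -> K} -> C) x' :
  permutation_invariant p -> (m + j <= N)%N ->
  \sum_y w y * norm2 y ^+ j * (monomial y x' * overlap y p) =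
  (m`! * \prod_(i < j) (#|K| + m + i))%:R * p x'.
Proof.
move=> p_inv mN; under eq_bigr do rewrite mulr_sumr mulr_sumr.
rewrite exchange_big /=.
transitivity (\sum_x p x * ((\prod_(i < j) (#|K| + m + i))%:R *
    \prod_c ((occ x' c == occ x c) * (occ x' c)`!)%:R)).
  apply: eq_bigr => x _; have := @design_norm2 j (occ x') (occ x).
  rewrite !occ_sum => <- //.
  rewrite mulr_sumr; apply: eq_bigr => y _; rewrite /monomial (prod_occ x') rmorph_prod /=.
  by rewrite (prod_occ x (fun c => (z y c)^*)); ring.
transitivity ((\prod_(i < j) (#|K| + m + i))%:R * p x' *
  \sum_(x : {ffun 'I_m -> K} | [forall c, occ x c == occ x' c]) \prod_c (occ x' c)`!%:R); last first.
  by rewrite sum_occ_fact ?occ_sum // natrM; ring.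
rewrite mulr_sumr [RHS]big_mkcond; apply: eq_bigr => x _ /=.
case: ifP => [/forallP e|/negbT/forallPn[c /negPf e]]; last first.
  by rewrite (bigD1 c) //= eq_sym e mul0n mul0r !mulr0.
rewrite (@permutation_invariant_occ _ _ _ p x x') => [|//|c]; last exact/eqP/e.
rewrite mulrCA mulrA; congr (_ * _); apply: eq_bigr => c _.
by rewrite eq_sym e mul1n.
Qed.

Lemma conj_overlap m y (p : {ffun 'I_m -> K} -> C) :
  (overlap y p)^* = \sum_x (p x)^* * monomial y x.
Proof. by rewrite rmorph_sum; apply: eq_bigr => x _; rewrite rmorphM /= conjCK. Qed.

Lemma overlap_eq0 m y (p : {ffun 'I_m -> K} -> C) :
  (0 < m)%N -> norm2 y = 0 -> overlap y p = 0.
Proof.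
move=> m_gt0 y0; rewrite /overlap big1 // => x _.
by rewrite /monomial (bigD1 (Ordinal m_gt0)) //= norm2_eq0 // mul0r conjC0 mulr0.
Qed.

Lemma overlap_norm j m (p : {ffun 'I_m -> K} -> C) :
  permutation_invariant p -> (m + j <= N)%N ->
  \sum_y w y * norm2 y ^+ j * ((overlap y p)^* * overlap y p) =
  (m`! * \prod_(i < j) (#|K| + m + i))%:R * \sum_x p x * (p x)^*.
Proof.
move=> p_inv mN.
have E y : w y * norm2 y ^+ j * ((overlap y p)^* * overlap y p) =
    \sum_x (p x)^* * (w y * norm2 y ^+ j * (monomial y x * overlap y p)).
  rewrite conj_overlap; move: (overlap y p) => v.
  by rewrite mulr_suml mulr_sumr; apply: eq_bigr => x _; ring.
under eq_bigr do rewrite E.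
rewrite exchange_big mulr_sumr; apply: eq_bigr => x _ /=.
by rewrite -mulr_sumr overlap_reproducing //; ring.
Qed.

(** * Cauchy-Schwarz bound for one symmetric tensor *)

Section Dominance.
Context {k l m : nat}.
Variables (h : 'I_k + 'I_l -> 'I_m) (hV : 'I_m -> 'I_k + 'I_l).
Hypotheses (hK : cancel h hV) (hVK : cancel hV h).
Hypotheses (k_gt0 : (0 < k)%N) (mkl : m = (k + l)%N) (mN : (m <= N)%N).
Variables (p : {ffun 'I_m -> K} -> C) (q : {ffun 'I_k -> K} -> C).
Hypothesis p_inv : permutation_invariant p.

(** [r] is the contraction of [p] with [q] over the kept systems and S its squared norm; F and G are
    the two functions compared by Cauchy-Schwarz. *)
Let r (t : {ffun 'I_l -> K}) := \sum_xi (q xi)^* * p (ffun_glue hV xi t).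
Let F y := overlap y p * (\sum_xi (q xi)^* * monomial y xi).
Let G y := overlap y r.
Let S := \sum_t r t * (r t)^*.

Lemma contraction_invariant : permutation_invariant r.
Proof.
move=> s t; apply: eq_bigr => xi _; congr (_ * _).
exact: (permutation_invariant_glue hK hVK xi p_inv).
Qed.

(** The monomials of the kept and discarded parts multiply to that of the glued word, where
    [overlap_reproducing] returns m! times [p]; summing against [q] and [r] yields S. *)
Lemma overlap_cross : \sum_y w y * ((G y)^* * F y) = m`!%:R * S.
Proof.
have E y : w y * ((G y)^* * F y) = \sum_t \sum_xi (r t)^* * (q xi)^* *
    (w y * norm2 y ^+ 0 * (monomial y (ffun_glue hV xi t) * overlap y p)).
  rewrite /G conj_overlap.
  rewrite /F; move: (overlap y p) => v.
  rewrite [X in _ * X = _]mulrCA [LHS]mulrA big_distrlr /= mulr_sumr.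
  apply: eq_bigr => t _; rewrite mulr_sumr; apply: eq_bigr => xi _.
  by rewrite /monomial (prod_glue hK hVK) expr0; ring.
under eq_bigr do rewrite E.
rewrite exchange_big mulr_sumr; apply: eq_bigr => t _ /=.
rewrite exchange_big /=; set c := (r t)^*.
rewrite [r t]/r mulr_suml mulr_sumr; apply: eq_bigr => xi _.
by rewrite -mulr_sumr overlap_reproducing ?addn0 // big_ord0 muln1; ring.
Qed.

Lemma overlap_contraction : \sum_y w y * norm2 y ^+ k * ((G y)^* * G y) =
  (l`! * \prod_(i < k) (#|K| + l + i))%:R * S.
Proof.
rewrite overlap_norm //; first exact: contraction_invariant.
by rewrite addnC -mkl.
Qed.

Lemma cross_eq0 y : norm2 y = 0 -> F y = 0.
Proof.
move=> y0; rewrite /F [X in _ * X]big1 ?mulr0 // => xi _.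
rewrite /monomial (bigD1 (Ordinal k_gt0)) //=.
by rewrite norm2_eq0 // mul0r mulr0.
Qed.

(* Cauchy-Schwarz in expanded form, valid for S = 0 as well. Where norm2 y = 0
   the division gives 0, which is harmless since F y = 0 there. *)
Lemma dominance_quadratic (s : C) : s \is Num.real ->
  2 * s * m`!%:R * S <= \sum_y w y * (`|F y| ^+ 2 / norm2 y ^+ k) +
    s ^+ 2 * ((l`! * \prod_(i < k) (#|K| + l + i))%:R * S).
Proof.
move=> /CrealP s_real.
have S_real : S^* = S.
  by rewrite rmorph_sum; apply: eq_bigr => t _; rewrite rmorphM /= conjCK mulrC.
have cross_conj : \sum_y w y * (G y * (F y)^*) = m`!%:R * S.
  have := congr1 (fun u : C => u^*) overlap_cross.
  rewrite rmorphM /= conjC_nat S_real => <-; rewrite rmorph_sum; apply: eq_bigr => y _.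
  by rewrite !rmorphM /= conjCK (CrealP (ger0_real (w_ge0 y))).
have : 0 <= \sum_y w y * (`|F y - s * norm2 y ^+ k * G y| ^+ 2 / norm2 y ^+ k).
  apply: sumr_ge0 => y _; rewrite mulr_ge0 // divr_ge0 ?exprn_ge0 ?normr_ge0 //.
  exact: norm2_ge0.
rewrite -[X in _ -> is_true X]subr_ge0; congr (is_true (0 <= _)).
rewrite -overlap_contraction mulr_sumr -big_split /=.
have -> : 2 * s * m`!%:R * S = s * (m`!%:R * S) + s * (m`!%:R * S) by ring.
rewrite -{1}overlap_cross -cross_conj !mulr_sumr -big_split /= -sumrB.
apply: eq_bigr => y _.
have nk_real : (norm2 y ^+ k)^* = norm2 y ^+ k.
  by apply/CrealP; rewrite ger0_real // exprn_ge0 // norm2_ge0.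
rewrite !normCK rmorphB /= [(s * _ * _)^*]rmorphM /= [(s * _)^*]rmorphM /= s_real nk_real.
have [y0|y0] := eqVneq (norm2 y) 0.
  rewrite y0 (cross_eq0 y0) expr0n (gtn_eqF k_gt0) invr0 conjC0 /= mulr0n; ring.
by field; rewrite expf_neq0.
Qed.

Lemma coherent_dominance : (k * #|K| <= m)%N ->
  (1 - (k * #|K|)%:R / m%:R) * S <=
    \sum_y w y / m`!%:R * (`|F y| ^+ 2 / norm2 y ^+ k).
Proof.
move=> kD; have S_ge0 : 0 <= S by apply: sumr_ge0 => t _; apply: mul_conjC_ge0.
have m_gt0 : (0 < m)%N by rewrite mkl addn_gt0 k_gt0.
set kap : nat := (l`! * \prod_(i < k) (#|K| + l + i))%N.
have mf0 : 0 < m`!%:R :> C by rewrite ltr0n fact_gt0.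
have m0 : 0 < m%:R :> C by rewrite ltr0n.
have bound : ((m - k * #|K|) * kap <= m * m`!)%N.
  have := @rising_factorial_bound k l #|K| k; rewrite [(l + k)%N]addnC -mkl.
  by move=> ->.
have -> : \sum_y w y / m`!%:R * (`|F y| ^+ 2 / norm2 y ^+ k) =
    (\sum_y w y * (`|F y| ^+ 2 / norm2 y ^+ k)) / m`!%:R.
  by rewrite mulr_suml; apply: eq_bigr => y _; rewrite mulrAC.
rewrite ler_pdivlMr //.
set c := (m - k * #|K|)%N in bound *.
have -> : 1 - (k * #|K|)%:R / m%:R = c%:R / m%:R :> C.
  by rewrite natrB // mulrBl divff ?gt_eqF.
(* With s = c / m, [bound] says s kap <= m!, so 2 s m! - s^2 kap is at least s m!, the coefficient
   wanted. *)
have := @dominance_quadratic (c%:R / m%:R).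
rewrite rpred_div ?realn // => /(_ isT); rewrite -/kap -lerBlDr; apply: le_trans.
rewrite -subr_ge0.
have -> : 2 * (c%:R / m%:R) * m`!%:R * S - (c%:R / m%:R) ^+ 2 * (kap%:R * S)
    - c%:R / m%:R * S * m`!%:R =
  c%:R / m%:R ^+ 2 * S * ((m * m`!)%:R - (c * kap)%:R) :> C.
  by rewrite !natrM; field; rewrite gt_eqF.
by rewrite !mulr_ge0 ?subr_ge0 ?ler_nat ?invr_ge0 ?exprn_ge0 ?ler0n.
Qed.

End Dominance.
End CoherentStates.

(** * Operators and measure-and-prepare protocols *)

Section PositiveOperators.
Context {R : realType}.
Implicit Types r n p : nat.

Lemma psdmxP n (A : 'M[R[i]]_n) :
  psdmx A <-> forall v : 'cV[R[i]]_n, 0 <= \sum_i \sum_j (v i 0)^* * A i j * v j 0.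
Proof. by split=> A_psd v; have := A_psd v; rewrite quad_formE. Qed.

Lemma psdmx_gram n p (T : 'M[R[i]]_(n, p)) : psdmx (T *m T ^t*).
Proof.
move=> v; have -> : v ^t* *m (T *m T ^t*) *m v = (T ^t* *m v) ^t* *m (T ^t* *m v).
  by rewrite trmx_mul map_mxM trmxCK !mulmxA.
rewrite mxE; apply: sumr_ge0 => k _; rewrite !mxE mulrC; exact: mul_conjC_ge0.
Qed.

Lemma psdmx_factor n (A : 'M[R[i]]_n) :
  psdmx A -> exists T : 'M[R[i]]_n, T *m T ^t* = A.
Proof. by move=> /psd_sqrt[T TT _]; exists T. Qed.

Lemma psdmx_sum (I : finType) n (A : I -> 'M[R[i]]_n) :
  (forall i, psdmx (A i)) -> psdmx (\sum_i A i).
Proof.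
move=> A_psd v; rewrite mulmx_sumr mulmx_suml summxE.
by apply: sumr_ge0 => i _; apply: A_psd.
Qed.

Lemma psdmx_scale n (c : R[i]) (A : 'M[R[i]]_n) :
  0 <= c -> psdmx A -> psdmx (c *: A).
Proof. by move=> c0 A_psd v; rewrite -scalemxAr -scalemxAl mxE mulr_ge0. Qed.

Lemma psdmx0 n : psdmx (0 : 'M[R[i]]_n).
Proof. by move=> v; rewrite mulmx0 mul0mx mxE. Qed.

Lemma psdmx1 n : psdmx (1%:M : 'M[R[i]]_n).
Proof.
by have := @psdmx_gram n n 1%:M; rewrite trmx1 map_mx1 mulmx1.
Qed.

(** Factoring B as a Gram matrix turns the trace into a sum of forms of A at the columns of the
    factor. *)
Lemma psdmx_trmul_ge0 n (A B : 'M[R[i]]_n) : psdmx A -> psdmx B -> 0 <= \tr (A *m B).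
Proof.
move=> A_psd /psdmx_factor[T <-]; rewrite mulmxA mxtrace_mulC mulmxA.
apply: sumr_ge0 => c _; have := A_psd (col c T); rewrite quad_formE => le0.
rewrite mxE exchange_big /= in le0 *.
apply: le_trans le0 _; rewrite le_eqVlt; apply/orP; left; apply/eqP.
apply: eq_bigr => j _; rewrite !mxE mulr_suml; apply: eq_bigr => i _.
by rewrite !mxE.
Qed.

Lemma psdmx_tens n p (A : 'M[R[i]]_n) (B : 'M[R[i]]_p) :
  psdmx A -> psdmx B -> psdmx (A *t B).
Proof.
move=> /psdmx_factor[T <-] /psdmx_factor[S <-].
by rewrite -tensmx_mul -map_mxT -trmx_tens; apply: psdmx_gram.
Qed.

(** The core of complete positivity for a measurement: with M factored through L, the form at u is
    the sum of the forms of X at u tensored with the columns of L. *)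
Lemma psdmx_block_trace r n (M : 'M[R[i]]_n) (X : 'M[R[i]]_(r * n)) :
  psdmx M -> psdmx X ->
  psdmx (\matrix_(i < r, j < r) \tr (M *m
    \matrix_(a, b) X (mxtens_index (i, a)) (mxtens_index (j, b)))).
Proof.
move=> /psdmx_factor[L <-] X_psd; apply/psdmxP => u.
pose V e : 'cV[R[i]]_(r * n) :=
  \col_k (u (mxtens_unindex k).1 0 * L (mxtens_unindex k).2 e).
have sum_tens (F : 'I_(r * n) -> R[i]) :
    \sum_k F k = \sum_i \sum_a F (mxtens_index (i, a)).
  rewrite pair_bigA (reindex (@mxtens_index r n)) /=; first by apply: eq_bigr => -[].
  by exists (@mxtens_unindex r n) => ? _; rewrite (mxtens_indexK, mxtens_unindexK).
suff -> : \sum_i \sum_j (u i 0)^* * (\matrix_(i, j) \tr (L *m L ^t* *m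
    \matrix_(a, b) X (mxtens_index (i, a)) (mxtens_index (j, b)))) i j * u j 0
    = \sum_e ((V e) ^t* *m X *m V e) 0 0.
  by apply: sumr_ge0 => e _; apply: X_psd.
under [RHS]eq_bigr => e _.
  rewrite quad_formE sum_tens.
  under eq_bigr => i _.
    rewrite exchange_big sum_tens /=.
    over.
  over.
rewrite [RHS]exchange_big /=; apply: eq_bigr => i _.
rewrite [RHS]exchange_big /=; apply: eq_bigr => j _.
rewrite !mxE -mulmxA mxtrace_mulC mulr_sumr mulr_suml; apply: eq_bigr => e _.
rewrite !mxE mulr_sumr mulr_suml; apply: eq_bigr => b _.
rewrite !mxE mulr_suml mulr_sumr mulr_suml; apply: eq_bigr => a _.
by rewrite !mxE !mxtens_indexK /= rmorphM /=; ring.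
Qed.

End PositiveOperators.

(** * Measure-and-prepare maps with finitely many outcomes *)

Section FiniteMeasurePrepare.
Context {R : realType} {n p N : nat}.
Variables (M : 'I_N -> 'M[R[i]]_n) (sigma : 'I_N -> 'M[R[i]]_p).

Definition finite_mp (rho : 'M[R[i]]_n) : 'M[R[i]]_p :=
  \sum_y \tr (M y *m rho) *: sigma y.

Fact finite_mp_is_linear : linear finite_mp.
Proof.
move=> a X Y; rewrite /finite_mp scaler_sumr -big_split; apply: eq_bigr => y _.
by rewrite mulmxDr -scalemxAr mxtraceD mxtraceZ scalerDl scalerA.
Qed.

HB.instance Definition _ := GRing.isLinear.Build R[i] 'M[R[i]]_n 'M[R[i]]_p
  *:%R finite_mp finite_mp_is_linear.

Hypothesis M_psd : forall y, psdmx (M y).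
Hypothesis M_le1 : psdmx (1%:M - \sum_y M y).
Hypothesis sigma_density : forall y, density (sigma y).

Lemma finite_mp_trace rho : \tr (finite_mp rho) = \tr ((\sum_y M y) *m rho).
Proof.
rewrite mulmx_suml !raddf_sum; apply: eq_bigr => y _ /=.
by rewrite mxtraceZ (sigma_density y).2 mulr1.
Qed.

Lemma finite_mp_quantum_operation : quantum_operation finite_mp.
Proof.
split=> [r X X_psd|X X_psd]; last first.
  rewrite finite_mp_trace -subr_ge0 -[X in X - _](congr1 _ (mul1mx X)).
  by rewrite -raddfB /= -mulmxBl; apply: psdmx_trmul_ge0.
(* Each outcome leaves a positive operator on the ancilla, tensored with the prepared state. *)
have -> : ampliation finite_mp X = \sum_y (\matrix_(i < r, j < r) \tr (M y *m
    \matrix_(a, b) X (mxtens_index (i, a)) (mxtens_index (j, b)))) *t sigma y.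
  apply/matrixP => i j; rewrite !mxE !summxE; apply: eq_bigr => y _.
  by rewrite !mxE.
apply: psdmx_sum => y; apply: psdmx_tens; last by case: (sigma_density y).
exact: psdmx_block_trace.
Qed.

End FiniteMeasurePrepare.

Section DiscreteOutcomes.
Local Open Scope classical_set_scope.
Context {R : realType}.

Lemma measurable_fun_nat d (T : measurableType d) (D : set nat) (f : nat -> T) :
  measurable_fun D f.
Proof. by []. Qed.

Lemma integral_msum_dirac (c : nat -> {nonneg R}) (N : nat) (D : set nat) (f : nat -> R) :
  (\int[msum (fun k => mscale (c k) (@dirac _ nat k R)) N]_(y in D) (f y)%:E =
   (\sum_(k < N) (c k)%:num * (\1_D (k : nat) * f k))%R%:E)%E.
Proof.
have pos (g : nat -> R) : (forall y, 0 <= g y)%R ->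
    (\int[msum (fun k => mscale (c k) (@dirac _ nat k R)) N]_(y in D) (g y)%:E =
     (\sum_(k < N) (c k)%:num * (\1_D (k : nat) * g k))%R%:E)%E.
  move=> g_ge0; rewrite ge0_integral_measure_sum //; last by move=> y _; rewrite lee_fin.
  rewrite -sumEFin; apply: eq_bigr => k _.
  rewrite ge0_integral_mscale //; last by move=> y _; rewrite lee_fin.
  by rewrite integral_dirac // !EFinM.
(* A signed integrand is split into its positive and negative parts, to which [pos] applies. *)
rewrite integralE.
have -> : ((fun y => (f y)%:E)^\+ = (fun y => (Num.max (f y) 0)%:E))%E.
  by apply/funext => y; rewrite funeposE EFin_max.
have -> : ((fun y => (f y)%:E)^\- = (fun y => (Num.max (- f y) 0)%:E))%E.
  by apply/funext => y; rewrite funenegE EFin_max.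
rewrite !pos => [|y|y]; try by rewrite le_max lexx orbT.
rewrite -EFinB -sumrB; congr (_%:E); apply: eq_bigr => k _.
rewrite -!mulrBr; congr (_ * (_ * _))%R.
case: (lerP 0 (f k)) => fk; case: (lerP 0 (- f k)) => fk'; lra.
Qed.

End DiscreteOutcomes.

Section FiniteProtocol.
Local Open Scope classical_set_scope.
Context {R : realType} {n p N : nat}.
Variables (M : 'I_N -> 'M[R[i]]_n) (sigma : 'I_N -> 'M[R[i]]_p).
Hypothesis M_psd : forall y, psdmx (M y).
Hypothesis M_le1 : psdmx (1%:M - \sum_y M y).
Hypothesis sigma_density : forall y, density (sigma y).

(** Outcomes are embedded in [nat], all of whose subsets are measurable. States are required only on
    [D], so the value 0 of [sigmaD] outside it is harmless. *)
Let D : set nat := [set y | (y < N)%N].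
Let povmM (A : set nat) : 'M[R[i]]_n := \sum_(y < N | (y : nat) \in A) M y.
Let sigmaD (y : nat) : 'M[R[i]]_p := if insub y is Some i then sigma i else 0.
Let prob (rho : 'M[R[i]]_n) (y : nat) : R :=
  if insub y is Some i then complex.Re (\tr (M i *m rho)) else 0.

Lemma outcome_prob_ge0 rho : psdmx rho -> forall y, 0 <= prob rho y.
Proof.
move=> rho_psd y; rewrite /prob; case: insubP => // i _ _.
by have := psdmx_trmul_ge0 (M_psd i) rho_psd; rewrite lecE => /andP[].
Qed.

Lemma outcome_measure_finite rho (rho_psd : psdmx rho) :
  outcome_measure povmM rho =
  msum (fun k => mscale (NngNum (outcome_prob_ge0 rho_psd k)) (@dirac _ nat k R)) N.
Proof.
apply/funext => A; rewrite /outcome_measure /msum /mscale /dirac /=.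
under [RHS]eq_bigr do rewrite /mscale /= -EFinM.
rewrite sumEFin; congr (_%:E).
rewrite /povmM mulmx_suml [\tr _]raddf_sum raddf_sum /= big_mkcond; apply: eq_bigr => y _.
rewrite /prob valK indicE; case: (_ \in _); first by rewrite mulr1.
by rewrite mulr0.
Qed.

Lemma finite_mp_pm_protocol : pm_protocol (finite_mp M sigma).
Proof.
split; first exact: finite_mp_quantum_operation.
exists default_measure_display, nat, D, povmM, sigmaD; split.
- by [].
- split; last first.
    rewrite /povmM (eq_bigl xpredT) // => y.
    by rewrite mem_set //; apply: ltn_ord.
  split=> [A _|rho rho_psd].
    by rewrite /povmM big_mkcond; apply: psdmx_sum => y; case: ifP => _; [exact: M_psd | exact: psdmx0].
  rewrite (outcome_measure_finite rho_psd).
  exact: measure_semi_sigma_additive.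
- by move=> y yN; rewrite /sigmaD insubT; apply: sigma_density.
- by move=> i j; split; apply: measurable_fun_nat.
move=> rho [rho_psd _]; apply/matrixP => i j; rewrite /measure_prepare !mxE.
rewrite (outcome_measure_finite rho_psd).
rewrite !integral_msum_dirac /= summxE.
have trE y : \tr (M y *m rho) = Complex (prob rho y) 0.
  have := psdmx_trmul_ge0 (M_psd y) rho_psd.
  rewrite /prob valK lecE => /andP[/eqP + _].
  by case: (\tr _) => a b /= ->.
have DE (y : 'I_N) : \1_D (y : nat) = 1 :> R by rewrite indicE mem_set //; apply: ltn_ord.
rewrite [LHS](_ : _ = \sum_(y < N) Complex (prob rho y * complex.Re (sigma y i j)) (prob rho y * complex.Im (sigma y i j))).
  apply/eqP; rewrite eq_complex; apply/andP; split.
    rewrite raddf_sum /=; apply/eqP; apply: eq_bigr => y _.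
    by rewrite DE mul1r /sigmaD valK.
  rewrite raddf_sum /=; apply/eqP; apply: eq_bigr => y _.
  by rewrite DE mul1r /sigmaD valK.
apply: eq_bigr => y _; rewrite mxE trE; case: (sigma y i j) => a b.
by congr Complex; rewrite /= mul0r ?subr0 ?addr0.
Qed.

End FiniteProtocol.

(** * Reduced states *)

(** Twice the error is at least tr[E1 rho0] + c tr[E0 rho0], hence at least c, because c <= 1 and
    the two traces add up to 1. *)
Lemma min_error_prob_ge {R : realType} (p : nat) (rho0 rho1 : 'M[R[i]]_p) (c : R) :
  density rho0 -> c <= 1 -> psdmx (rho1 - c%:C%C *: rho0) ->
  c / 2 <= min_error_prob rho0 rho1.
Proof.
move=> [rho0_psd rho0_tr] c1 dom; apply: lb_le_inf.
  exists (2^-1 * complex.Re (\tr (0 *m rho0)) + 2^-1 * complex.Re (\tr (1%:M *m rho1))).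
  by exists 1%:M, 0; split; [exact: psdmx1 | exact: psdmx0 | rewrite addr0 | ].
move=> _ [E0 [E1 [E0_psd E1_psd E01 ->]]].
have Re_ge0 (u : R[i]) : 0 <= u -> 0 <= complex.Re u by rewrite lecE => /andP[].
have := Re_ge0 _ (psdmx_trmul_ge0 E0_psd dom).
have := Re_ge0 _ (psdmx_trmul_ge0 E1_psd rho0_psd).
have : complex.Re (\tr (E0 *m rho0)) + complex.Re (\tr (E1 *m rho0)) = 1.
  by rewrite -raddfD /= -mxtraceD -mulmxDl E01 mul1mx rho0_tr.
rewrite mulmxBr -scalemxAr [\tr (_ - _)]raddfB /= mxtraceZ.
have -> (u v : R[i]) : complex.Re (u - c%:C%C * v) = complex.Re u - c * complex.Re v.
  by case: u v => [a b] [a' b'] /=; rewrite mul0r subr0.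
nra.
Qed.

Lemma sum_trank (V : nmodType) d m (F : 'I_(tdim d m) -> V) :
  \sum_i F i = \sum_(u : {ffun 'I_m -> 'I_d}) F (trank u).
Proof.
rewrite (reindex trank) //.
by exists tindex => x _; rewrite (tindexK, trankK).
Qed.

(** Enumerating the discarded systems makes every word on m systems a glued pair, for an arbitrary
    choice of kept systems. *)
Lemma injection_complement k m (f : 'I_k -> 'I_m) : injective f ->
  exists (l : nat) (h : 'I_k + 'I_l -> 'I_m) (hV : 'I_m -> 'I_k + 'I_l),
    [/\ cancel h hV, cancel hV h, m = (k + l)%N,
        (forall a, h (inl a) = f a) & forall b, h (inr b) \notin codom f].
Proof.
move=> f_inj; pose l := #|[predC codom f]|.
pose h (u : 'I_k + 'I_l) : 'I_m := match u with inl a => f a | inr b => enum_val b end.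
have hC b : h (inr b) \notin codom f by have := enum_valP b; rewrite inE.
have mE : m = (k + l)%N.
  have := cardC [pred i | i \in codom f]; rewrite card_ord => <-.
  by congr (_ + _)%N; rewrite card_codom // card_ord.
have h_inj : injective h.
  move=> [a|b] [a'|b'] e.
  - by congr inl; apply: f_inj.
  - by have := hC b'; rewrite -e /= codom_f.
  - by have := hC b; rewrite e /= codom_f.
  - by congr inr; apply: enum_val_inj.
have [|hV hK hVK] := inj_card_bij h_inj.
  by rewrite card_sum !card_ord mE.
by exists l, h, hV.
Qed.

Section PartialTrace.
Context {R : realType} {d k l m : nat} (f : 'I_k -> 'I_m).
Variables (h : 'I_k + 'I_l -> 'I_m) (hV : 'I_m -> 'I_k + 'I_l).
Hypotheses (hK : cancel h hV) (hVK : cancel hV h).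
Hypotheses (hf : forall a, h (inl a) = f a) (hC : forall b, h (inr b) \notin codom f).

(** The constraints in [ptrace] force the two words to be glued from the row and column indices with
    one common word on the traced-out systems. *)
Lemma ptrace_glue (X : 'M[R[i]]_(tdim d m)) i j :
  ptrace f X i j = \sum_(t : {ffun 'I_l -> 'I_d})
    X (trank (ffun_glue hV (tindex i) t)) (trank (ffun_glue hV (tindex j) t)).
Proof.
have headE (xi eta : {ffun 'I_k -> 'I_d}) t :
    [forall a, ffun_glue hV xi t (f a) == eta a] = (xi == eta).
  apply/forallP/eqP => [e|-> a]; last by rewrite -hf (ffun_glue_inl hK).
  by apply/ffunP => a; have := e a; rewrite -hf (ffun_glue_inl hK) => /eqP.
have tailE (xi xi' : {ffun 'I_k -> 'I_d}) t t' :
    [forall b, (b \notin codom f) ==> (ffun_glue hV xi t b == ffun_glue hV xi' t' b)] = (t == t').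
  apply/forallP/eqP => [e|-> b].
    apply/ffunP => b; have := e (h (inr b)).
    by rewrite hC !(ffun_glue_inr hK) => /eqP.
  apply/implyP; rewrite -(hVK b); case: (hV b) => [a|b'].
    by rewrite hf codom_f.
  by rewrite !(ffun_glue_inr hK).
rewrite mxE big_mkcond (sum_glue hK hVK) (bigD1 (tindex i)) //=.
rewrite [X in _ + X]big1 ?addr0 => [|xi /negPf xi_i]; last first.
  by rewrite big1 // => t _; rewrite headE xi_i.
apply: eq_bigr => t _; rewrite headE eqxx big_mkcond (sum_glue hK hVK).
rewrite (bigD1 (tindex j)) //= [X in _ + X]big1 ?addr0 => [|xi /negPf xi_j]; last first.
  by rewrite big1 // => t' _; rewrite headE xi_j.
rewrite (bigD1 t) //= headE tailE !eqxx big1 ?addr0 // => t' /negPf t't.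
by rewrite tailE eq_sym t't andbF.
Qed.

Lemma ptrace_trace (X : 'M[R[i]]_(tdim d m)) : \tr (ptrace f X) = \tr X.
Proof.
rewrite /mxtrace; under eq_bigr do rewrite ptrace_glue.
rewrite !sum_trank (sum_glue hK hVK); apply: eq_bigr => xi _.
by apply: eq_bigr => t _; rewrite trankK.
Qed.

End PartialTrace.

(** * Systems paired with purifying partners *)

Section PairedSystems.
Context {R : realType} {d : nat}.
Local Notation K := ('I_d * 'I_d)%type.

Definition pairf m (u v : {ffun 'I_m -> 'I_d}) : {ffun 'I_m -> K} :=
  [ffun i => (u i, v i)].

Lemma sum_pairf (V : nmodType) m (F : {ffun 'I_m -> K} -> V) :
  \sum_x F x = \sum_u \sum_v F (pairf u v).
Proof.
rewrite pair_bigA /= (reindex (fun uv => pairf uv.1 uv.2)) //.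
exists (fun x : {ffun 'I_m -> K} => ([ffun i => (x i).1], [ffun i => (x i).2])).
  by move=> [u v] _; congr pair; apply/ffunP => i; rewrite !ffunE.
by move=> x _; apply/ffunP => i; rewrite !ffunE; case: (x i).
Qed.

Lemma glue_pairf k l m (hV : 'I_m -> 'I_k + 'I_l) xi eta t v :
  pairf (ffun_glue hV xi t) (ffun_glue hV eta v) = ffun_glue hV (pairf xi eta) (pairf t v).
Proof. by apply/ffunP => i; rewrite !ffunE; case: (hV i) => a; rewrite ffunE. Qed.

(* The vector e on k systems tensored with the basis vector eta of their k
   purifying partners. *)
Definition slice k (e : 'cV[R[i]]_(tdim d k)) (eta : {ffun 'I_k -> 'I_d})
    (x : {ffun 'I_k -> K}) : R[i] :=
  if [ffun i => (x i).2] == eta then e (trank [ffun i => (x i).1]) 0 else 0.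

Lemma sum_slice k (e : 'cV[R[i]]_(tdim d k)) eta (F : {ffun 'I_k -> K} -> R[i]) :
  \sum_x (slice e eta x)^* * F x = \sum_u (e (trank u) 0)^* * F (pairf u eta).
Proof.
rewrite sum_pairf; apply: eq_bigr => u _.
have sliceE v : slice e eta (pairf u v) = if v == eta then e (trank u) 0 else 0.
  rewrite /slice (_ : [ffun i => _] = v); last by apply/ffunP => i; rewrite !ffunE.
  by rewrite (_ : [ffun i => _] = u) //; apply/ffunP => i; rewrite !ffunE.
rewrite (bigD1 eta) //= sliceE eqxx big1 ?addr0 // => v /negPf v_eta.
by rewrite sliceE v_eta conjC0 mul0r.
Qed.

Section ReducedForm.
Context {k l m : nat} (f : 'I_k -> 'I_m).
Variables (h : 'I_k + 'I_l -> 'I_m) (hV : 'I_m -> 'I_k + 'I_l).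
Hypotheses (hK : cancel h hV) (hVK : cancel hV h).
Hypotheses (hf : forall a, h (inl a) = f a) (hC : forall b, h (inr b) \notin codom f).

(** Tracing out the partners of the kept systems ([eta]) and the discarded pairs ([t]) leaves
    squared norms of contractions, the quantity bounded in [coherent_dominance]. *)
Lemma ptrace_quad_form (B : finType) (p : B -> {ffun 'I_m -> K} -> R[i])
    (X : 'M[R[i]]_(tdim d m)) (e : 'cV[R[i]]_(tdim d k)) :
  (forall u u', X (trank u) (trank u') =
     \sum_b \sum_v p b (pairf u v) * (p b (pairf u' v))^*) ->
  (e ^t* *m ptrace f X *m e) 0 0 =
  \sum_b \sum_eta \sum_t
    (\sum_xi (slice e eta xi)^* * p b (ffun_glue hV xi t)) *
    (\sum_xi (slice e eta xi)^* * p b (ffun_glue hV xi t))^*.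
Proof.
move=> XE; rewrite quad_formE sum_trank; under eq_bigr do rewrite sum_trank.
transitivity (\sum_xi \sum_xi' \sum_b \sum_eta \sum_t \sum_v
  (e (trank xi) 0)^* * p b (ffun_glue hV (pairf xi eta) (pairf t v)) *
  ((e (trank xi') 0)^* * p b (ffun_glue hV (pairf xi' eta) (pairf t v)))^*).
  apply: eq_bigr => xi _; apply: eq_bigr => xi' _.
  rewrite (ptrace_glue hK hVK hf hC) !trankK mulr_sumr mulr_suml.
  under eq_bigr do rewrite XE mulr_sumr mulr_suml.
  rewrite exchange_big /=; apply: eq_bigr => b _.
  rewrite exchange_big /=; apply: eq_bigr => t _.
  rewrite (sum_glue hK hVK) mulr_sumr mulr_suml; apply: eq_bigr => eta _.
  rewrite mulr_sumr mulr_suml; apply: eq_bigr => v _.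
  by rewrite -!glue_pairf rmorphM /= conjCK; ring.
under eq_bigr do rewrite exchange_big /=.
rewrite exchange_big /=; apply: eq_bigr => b _.
under eq_bigr do rewrite exchange_big /=.
rewrite exchange_big /=; apply: eq_bigr => eta _.
rewrite sum_pairf; under eq_bigr do rewrite exchange_big /=.
rewrite exchange_big /=; apply: eq_bigr => t _.
under eq_bigr do rewrite exchange_big /=.
rewrite exchange_big /=; apply: eq_bigr => v _.
rewrite !sum_slice rmorph_sum mulr_suml; apply: eq_bigr => xi _.
by rewrite mulr_sumr.
Qed.

End ReducedForm.

(** The normalised pure state of a system and its partner along [z], with the partner traced out. *)
Definition coherent_state (z : K -> R[i]) : 'M[R[i]]_d :=
  (\sum_c z c * (z c)^*)^-1 *: \matrix_(i, j) \sum_v z (i, v) * (z (j, v))^*.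

Lemma coherent_quad_form (Y : finType) (z : Y -> K -> R[i]) y k
    (e : 'cV[R[i]]_(tdim d k)) :
  (e ^t* *m tensor_op (fun _ : 'I_k => coherent_state (z y)) *m e) 0 0 =
  \sum_eta `|\sum_xi (slice e eta xi)^* * monomial z y xi| ^+ 2 / norm2 z y ^+ k.
Proof.
rewrite quad_formE sum_trank; under eq_bigr do rewrite sum_trank.
under [RHS]eq_bigr => eta _.
  rewrite normCK sum_slice rmorph_sum big_distrlr mulr_suml /=.
  under eq_bigr do rewrite mulr_suml.
  over.
rewrite [RHS]exchange_big; apply: eq_bigr => u _ /=.
rewrite [RHS]exchange_big; apply: eq_bigr => u' _ /=.
have entry i j : coherent_state (z y) i j =
    (norm2 z y)^-1 * \sum_v z y (i, v) * (z y (j, v))^* by rewrite !mxE.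
rewrite mxE !trankK (eq_bigr _ (fun i _ => entry _ _)).
rewrite big_split /= prodr_const card_ord exprVn bigA_distr_bigA /=.
rewrite !mulr_sumr mulr_suml; apply: eq_bigr => v _.
rewrite rmorphM /= conjCK /monomial rmorph_prod big_split /=.
have -> (F : K -> R[i]) (u0 : {ffun 'I_k -> 'I_d}) :
    \prod_i F (pairf u0 v i) = \prod_i F (u0 i, v i).
  by apply: eq_bigr => i _; rewrite ffunE.
have -> : \prod_i (z y (pairf u' v i))^* = \prod_i (z y (u' i, v i))^*.
  by apply: eq_bigr => i _; rewrite ffunE.
by ring.
Qed.

Lemma coherent_state_trace (Y : finType) (z : Y -> K -> R[i]) y :
  norm2 z y != 0 -> \tr (coherent_state (z y)) = 1.
Proof.
move=> y0; rewrite mxtraceZ (_ : \tr _ = norm2 z y) ?mulVf //.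
rewrite /mxtrace /norm2; under eq_bigr do rewrite mxE.
by rewrite pair_bigA; apply: eq_bigr => -[].
Qed.

Lemma tensor_coherent_density (Y : finType) (z : Y -> K -> R[i]) y k :
  norm2 z y != 0 -> density (tensor_op (fun _ : 'I_k => coherent_state (z y))).
Proof.
move=> y0; split=> [e|].
  rewrite coherent_quad_form; apply: sumr_ge0 => eta _.
  by rewrite divr_ge0 ?exprn_ge0 ?norm2_ge0.
rewrite /mxtrace sum_trank; under eq_bigr => u _ do rewrite mxE trankK.
rewrite -(bigA_distr_bigA (fun (_ : 'I_k) j => coherent_state (z y) j j)).
by rewrite big1 // => _ _; apply: coherent_state_trace.
Qed.

End PairedSystems.

(** * Symmetric purification and conclusion *)

Section Purification.
Context {R : realType} {n d m : nat}.
Local Notation K := ('I_d * 'I_d)%type.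
Variable Phi : {linear 'M[R[i]]_n -> 'M[R[i]]_(tdim d m)}.

Lemma permute_index_inj (s : 'S_m) : injective (@permute_index d m s).
Proof.
move=> i j /(can_inj (@trankK d m))/ffunP e; apply: (can_inj (@tindexK d m)).
by apply/ffunP => l; have := e (s l); rewrite !ffunE permK.
Qed.

(* chi b a (pairf u v) is the ((a, u), (b, v)) entry of the square root of the
   Choi matrix; (b, v) labels the Kraus operators of Phi. *)
Lemma symmetric_purification :
  completely_positive Phi -> perm_invariant_output Phi ->
  exists chi : 'I_n -> 'I_n -> {ffun 'I_m -> K} -> R[i],
    (forall b a, permutation_invariant (chi b a)) /\
    forall a a' u u', Phi (delta_mx a a') (trank u) (trank u') =
      \sum_b \sum_v chi b a (pairf u v) * (chi b a' (pairf u' v))^*.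
Proof.
move=> Phi_cp Phi_inv.
(* The unnormalised maximally entangled vector; applying [Phi] to half of it gives the Choi matrix
   [J], with blocks [Phi (delta_mx a a')]. *)
pose Om : 'cV[R[i]]_(n * n) :=
  \col_k ((mxtens_unindex k).1 == (mxtens_unindex k).2)%:R.
pose J := ampliation Phi (Om *m Om ^t*).
have JE a a' u u' : J (mxtens_index (a, u)) (mxtens_index (a', u')) =
    Phi (delta_mx a a') u u'.
  rewrite !mxE !mxtens_indexK /=; congr (Phi _ u u'); apply/matrixP => b b'.
  rewrite !mxE big_ord1 !mxE !mxtens_indexK /= conjC_nat -natrM mulnb.
  by rewrite ![b == _]eq_sym ![b' == _]eq_sym.
have [S SS S_comm] := psd_sqrt (Phi_cp n _ (psdmx_gram Om)).
pose tau (s : 'S_m) k :=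
  mxtens_index ((mxtens_unindex k).1, @permute_index d m s (mxtens_unindex k).2) : 'I_(n * _).
have tau_inj s : injective (tau s).
  move=> i j; rewrite /tau -[in i = j](mxtens_unindexK i) -[in _ = j](mxtens_unindexK j).
  case: (mxtens_unindex i) (mxtens_unindex j) => [a u] [a' u'] /=.
  move=> /(can_inj (@mxtens_indexK _ _)) e.
  by rewrite [a](congr1 fst e) (permute_index_inj (congr1 snd e)).
(* Invariance of the entries is restated as commutation with a permutation matrix, the form in which
   it passes from [J] to its root [S]. *)
have perm_comm s (A : 'M[R[i]]_(n * tdim d m)) :
    comm_mx (perm_mx (perm (@tau_inj s))) A <-> forall i j, A (tau s i) (tau s j) = A i j.
  rewrite /comm_mx -row_permE -[in X in _ = X](invgK (perm (@tau_inj s))) -col_permE.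
  split=> [/matrixP e i j|e].
    by have := e i (tau s j); rewrite !mxE permE -[tau s j]permE permK permE.
  apply/matrixP => i j; rewrite !mxE permE.
  by rewrite -[in LHS](permKV (perm (@tau_inj s)) j) permE e.
have S_inv s i j : S (tau s i) (tau s j) = S i j.
  apply: (perm_comm s S).1; apply: S_comm; apply/perm_comm => {}i {}j.
  rewrite -/J -[i in RHS]mxtens_unindexK -[j in RHS]mxtens_unindexK.
  rewrite /tau; case: (mxtens_unindex i) (mxtens_unindex j) => [a u] [a' u'] /=.
  by rewrite !JE -[in RHS](Phi_inv s) mxE.
exists (fun b a x => S (mxtens_index (a, trank [ffun i => (x i).1]))
                      (mxtens_index (b, trank [ffun i => (x i).2]))).
split=> [b a s x|a a' u u'].
  (* [permute_index] reads words through the inverse permutation, hence the inverse here. *)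
  rewrite -[RHS](S_inv s^-1%g) /tau !mxtens_indexK /permute_index /= !trankK.
  by congr (S (mxtens_index (a, trank _)) (mxtens_index (b, trank _)));
    apply/ffunP => l; rewrite !ffunE invgK.
rewrite -JE /J -SS mxE.
rewrite (reindex (@mxtens_index n (tdim d m))) /=; last first.
  by exists (@mxtens_unindex n (tdim d m)) => ? _; rewrite (mxtens_indexK, mxtens_unindexK).
transitivity (\sum_(b < n) \sum_(v < tdim d m)
    S (mxtens_index (a, trank u)) (mxtens_index (b, v)) *
    (S ^t*) (mxtens_index (b, v)) (mxtens_index (a', trank u'))).
  by rewrite pair_bigA /=; apply: eq_bigr => -[b v].
have fstE (u0 v : {ffun 'I_m -> 'I_d}) : [ffun i => (pairf u0 v i).1] = u0.
  by apply/ffunP => i; rewrite !ffunE.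
have sndE (u0 v : {ffun 'I_m -> 'I_d}) : [ffun i => (pairf u0 v i).2] = v.
  by apply/ffunP => i; rewrite !ffunE.
apply: eq_bigr => b _; rewrite sum_trank; apply: eq_bigr => v _.
by rewrite !mxE !fstE !sndE.
Qed.

Section Purified.
Variable chi : 'I_n -> 'I_n -> {ffun 'I_m -> K} -> R[i].
Hypothesis chi_inv : forall b a, permutation_invariant (chi b a).
Hypothesis chiE : forall a a' u u', Phi (delta_mx a a') (trank u) (trank u') =
  \sum_b \sum_v chi b a (pairf u v) * (chi b a' (pairf u' v))^*.

(** For the input T T^*, [bc.2] selects a column of T and [bc.1] is the part of the Kraus label not
    carried by the partners; what remains is a symmetric tensor over the pairs. *)
Definition purified (T : 'M[R[i]]_n) (bc : 'I_n * 'I_n) (x : {ffun 'I_m -> K}) :=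
  \sum_a T a bc.2 * chi bc.1 a x.

Lemma purified_inv T bc : permutation_invariant (purified T bc).
Proof. by move=> s x; apply: eq_bigr => a _; rewrite chi_inv. Qed.

Lemma purifiedE (T : 'M[R[i]]_n) u u' : Phi (T *m T ^t*) (trank u) (trank u') =
  \sum_bc \sum_v purified T bc (pairf u v) * (purified T bc (pairf u' v))^*.
Proof.
have PhiE X : Phi X (trank u) (trank u') = \sum_a \sum_a' X a a' *
    \sum_b \sum_v chi b a (pairf u v) * (chi b a' (pairf u' v))^*.
  rewrite {1}[X]matrix_sum_delta linear_sum summxE; apply: eq_bigr => a _.
  rewrite linear_sum summxE; apply: eq_bigr => a' _.
  by rewrite linearZ mxE chiE.
transitivity (\sum_a \sum_c \sum_a' T a c * (T a' c)^* *
    \sum_b \sum_v chi b a (pairf u v) * (chi b a' (pairf u' v))^*).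
  rewrite PhiE; apply: eq_bigr => a _; rewrite exchange_big; apply: eq_bigr => a' _.
  by rewrite mxE mulr_suml; apply: eq_bigr => c _; rewrite !mxE.
rewrite exchange_big /=.
transitivity (\sum_b \sum_c \sum_v purified T (b, c) (pairf u v) *
    (purified T (b, c) (pairf u' v))^*); last first.
  by rewrite pair_bigA; apply: eq_bigr => -[b c].
rewrite [RHS]exchange_big /=.
apply: eq_bigr => c _.
under [RHS]eq_bigr => b _.
  under eq_bigr => v _.
    rewrite /purified rmorph_sum big_distrlr /=.
    over.
  rewrite exchange_big /=.
  over.
rewrite [RHS]exchange_big /=; apply: eq_bigr => a _.
under [RHS]eq_bigr => b _ do rewrite exchange_big /=.
rewrite [RHS]exchange_big /=; apply: eq_bigr => a' _.
rewrite mulr_sumr; apply: eq_bigr => b _.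
rewrite mulr_sumr; apply: eq_bigr => v _.
by rewrite rmorphM /=; ring.
Qed.

Lemma purified_trace (T : 'M[R[i]]_n) : \tr (Phi (T *m T ^t*)) =
  \sum_bc \sum_x purified T bc x * (purified T bc x)^*.
Proof.
rewrite /mxtrace sum_trank; under eq_bigr do rewrite purifiedE.
rewrite exchange_big; apply: eq_bigr => bc _ /=.
by rewrite sum_pairf.
Qed.

Section Effects.
Context {Y : finType}.
Variables (w : Y -> R[i]) (z : Y -> K -> R[i]).
Hypothesis w_ge0 : forall y, 0 <= w y.

(** Detection of the tensor power of [z y] on the m purified pairs, pulled back to the input and
    summed over the unobserved label b; 1 / m! normalises the resolution of the identity. *)
Definition effect y : 'M[R[i]]_n := (w y / m`!%:R) *:
  \sum_b (\col_a (overlap z y (chi b a))^*) *m (\col_a (overlap z y (chi b a))^*) ^t*.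

Lemma effect_psd y : psdmx (effect y).
Proof.
apply: psdmx_scale; first by rewrite divr_ge0 ?ler0n.
by apply: psdmx_sum => b; apply: psdmx_gram.
Qed.

Lemma overlap_purified T b c y :
  overlap z y (purified T (b, c)) = \sum_a T a c * overlap z y (chi b a).
Proof.
rewrite /overlap; under eq_bigr do rewrite mulr_suml.
rewrite exchange_big; apply: eq_bigr => a _ /=.
by rewrite mulr_sumr; apply: eq_bigr => x _; rewrite mulrA.
Qed.

Lemma effect_prob T y : \tr (effect y *m (T *m T ^t*)) =
  \sum_bc w y / m`!%:R * `|overlap z y (purified T bc)| ^+ 2.
Proof.
rewrite -scalemxAl mxtraceZ mulmx_suml raddf_sum /= -mulr_sumr; congr (_ * _).
transitivity (\sum_b \sum_c `|overlap z y (purified T (b, c))| ^+ 2); last first.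
  by rewrite pair_bigA; apply: eq_bigr => -[b c].
apply: eq_bigr => b _; set l := \col_a _.
have -> : l *m l ^t* *m (T *m T ^t*) = (l *m (l ^t* *m T)) *m T ^t*.
  by rewrite !mulmxA.
rewrite mxtrace_mulC mulmxA mxtrace_mulC /mxtrace big_ord1 mxE.
apply: eq_bigr => c _; rewrite normCK overlap_purified mxE rmorph_sum; congr (_ * _).
  by apply: eq_bigr => a _; rewrite !mxE conjCK mulrC.
by rewrite mxE; apply: eq_bigr => a _; rewrite !mxE rmorphM.
Qed.

End Effects.
End Purified.
End Purification.

(** * The coherent-state protocol and its reduced outputs *)

Section CoherentProtocol.
Context {R : realType} {n d m : nat}.
Local Notation K := ('I_d * 'I_d)%type.
Hypothesis m_gt0 : (0 < m)%N.
Variable Phi : {linear 'M[R[i]]_n -> 'M[R[i]]_(tdim d m)}.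
Hypothesis Phi_le1 : trace_nonincreasing Phi.
Variable chi : 'I_n -> 'I_n -> {ffun 'I_m -> K} -> R[i].
Hypothesis chi_inv : forall b a, permutation_invariant (chi b a).
Hypothesis chiE : forall a a' u u', Phi (delta_mx a a') (trank u) (trank u') =
  \sum_b \sum_v chi b a (pairf u v) * (chi b a' (pairf u' v))^*.
Context {Y : finType}.
Variables (w : Y -> R[i]) (z : Y -> K -> R[i]).
Hypothesis w_ge0 : forall y, 0 <= w y.
Hypothesis design : forall a b : K -> nat,
  (forall c, (a c <= m)%N) -> (forall c, (b c <= m)%N) ->
  \sum_y w y * (\prod_c z y c ^+ a c * \prod_c (z y c)^* ^+ b c) =
  \prod_c ((a c == b c) * (a c)`!)%:R.

(* If z y = 0 the effect vanishes and coherent_state is not a state. *)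
Let outcomes := [pred y | norm2 z y != 0].
Let M (i : 'I_#|outcomes|) : 'M[R[i]]_n := effect chi w z (enum_val i).
Let sigma (i : 'I_#|outcomes|) : 'M[R[i]]_(tdim d m) :=
  tensor_op (fun _ => coherent_state (z (enum_val i))).

Definition coherent_protocol : 'M[R[i]]_n -> 'M[R[i]]_(tdim d m) := finite_mp M sigma.

HB.instance Definition _ := GRing.Linear.on coherent_protocol.

(** This preserves the success probability: outcomes with z y = 0 can be restored since their
    overlaps vanish for m > 0, and [overlap_norm] with j = 0 then gives the norm of each purified
    tensor. *)
Lemma coherent_effect_sum (T : 'M[R[i]]_n) :
  \tr ((\sum_i M i) *m (T *m T ^t*)) = \tr (Phi (T *m T ^t*)).
Proof.
rewrite (purified_trace chiE) mulmx_suml raddf_sum /=.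
rewrite -(big_enum_val (fun y => \tr (effect chi w z y *m (T *m T ^t*)))) /=.
transitivity (\sum_y \tr (effect chi w z y *m (T *m T ^t*))).
  rewrite big_mkcond; apply: eq_bigr => y _; rewrite inE.
  case: eqP => //= y0; rewrite effect_prob big1 // => bc _.
  by rewrite overlap_eq0 // normr0 expr0n mulr0.
under [LHS]eq_bigr do rewrite effect_prob.
rewrite exchange_big; apply: eq_bigr => bc _ /=.
have m0 : m`!%:R != 0 :> R[i] by rewrite pnatr_eq0 -lt0n fact_gt0.
apply: (mulfI m0).
have := overlap_norm design (purified_inv chi_inv T bc) (_ : m + 0 <= m)%N.
rewrite addn0 leqnn => /(_ isT); rewrite big_ord0 muln1 => <-.
rewrite mulr_sumr; apply: eq_bigr => y _.
by rewrite normCK expr0; field.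
Qed.

Lemma coherent_effect_le1 : psdmx (1%:M - \sum_i M i).
Proof.
(* The form at v is the trace lost by [Phi] on the rank-one input along v. *)
move=> v; have -> : (v ^t* *m (1%:M - \sum_i M i) *m v) 0 0 =
    \tr (v *m v ^t*) - \tr ((\sum_i M i) *m (v *m v ^t*)).
  rewrite -raddfB /= -[X in \tr (X - _)]mul1mx -mulmxBl mulmxA mxtrace_mulC mulmxA.
  by rewrite /mxtrace big_ord1.
have [T TT] := psdmx_factor (psdmx_gram v).
by rewrite -TT coherent_effect_sum subr_ge0 Phi_le1 //; apply: psdmx_gram.
Qed.

Lemma coherent_protocol_pm : pm_protocol coherent_protocol.
Proof.
apply: finite_mp_pm_protocol => [y||y].
- exact: effect_psd.
- exact: coherent_effect_le1.
- by apply: tensor_coherent_density; have := enum_valP y; rewrite inE.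
Qed.

Lemma coherent_protocol_trace rho : psdmx rho ->
  \tr (coherent_protocol rho) = \tr (Phi rho).
Proof.
move=> /psdmx_factor[T <-]; rewrite finite_mp_trace ?coherent_effect_sum // => y.
by apply: tensor_coherent_density; have := enum_valP y; rewrite inE.
Qed.

Section Reduced.
Context {k : nat} (f : 'I_k -> 'I_m).
Hypothesis f_inj : injective f.

(** Every prepared state is a product of unit-trace factors, so the partial trace just keeps k of
    them. Null outcomes are restored at no cost, as their effects vanish. *)
Lemma ptrace_coherent_quad_form (T : 'M[R[i]]_n) (e : 'cV[R[i]]_(tdim d k)) : (0 < k)%N ->
  (e ^t* *m ptrace f (coherent_protocol (T *m T ^t*)) *m e) 0 0 =
  \sum_bc \sum_eta \sum_y w y / m`!%:R * (`|overlap z y (purified chi T bc) *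
    \sum_xi (slice e eta xi)^* * monomial z y xi| ^+ 2 / norm2 z y ^+ k).
Proof.
move=> k_gt0.
have ptrace_lin (I : finType) (c : I -> R[i]) (X : I -> 'M[R[i]]_(tdim d m)) :
    ptrace f (\sum_i c i *: X i) = \sum_i c i *: ptrace f (X i).
  apply/matrixP => i j; rewrite mxE summxE.
  under [RHS]eq_bigr do rewrite !mxE mulr_sumr.
  rewrite [RHS]exchange_big; apply: eq_bigr => u _ /=.
  under [RHS]eq_bigr do rewrite mulr_sumr.
  rewrite [RHS]exchange_big; apply: eq_bigr => v _ /=.
  by rewrite summxE; apply: eq_bigr => y _; rewrite mxE.
rewrite /coherent_protocol /finite_mp ptrace_lin mulmx_sumr mulmx_suml summxE.
pose term y := \tr (effect chi w z y *m (T *m T ^t*)) *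
  \sum_eta `|\sum_xi (slice e eta xi)^* * monomial z y xi| ^+ 2 / norm2 z y ^+ k.
transitivity (\sum_(i < #|outcomes|) term (enum_val i)).
  apply: eq_bigr => i _; rewrite /sigma ptrace_tensor // big1 ?scale1r => [|l _].
    by rewrite -scalemxAr -scalemxAl mxE coherent_quad_form.
  by apply: coherent_state_trace; have := enum_valP i; rewrite inE.
rewrite -(big_enum_val term) /=.
transitivity (\sum_y term y).
  rewrite big_mkcond; apply: eq_bigr => y _; rewrite inE.
  case: eqP => //= y0; rewrite /term effect_prob big1 ?mul0r // => bc _.
  by rewrite overlap_eq0 // normr0 expr0n mulr0.
rewrite /term; under [LHS]eq_bigr do rewrite effect_prob mulr_suml.
rewrite exchange_big; apply: eq_bigr => bc _ /=.
under eq_bigr do rewrite mulr_sumr.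
rewrite exchange_big; apply: eq_bigr => eta _ /=.
by apply: eq_bigr => y _; rewrite normrM exprMn; ring.
Qed.

Lemma ptrace_psd rho : psdmx rho -> psdmx (ptrace f (Phi rho)).
Proof.
move=> /psdmx_factor[T <-] e.
have [l [h [hV [hK hVK _ hf hC]]]] := injection_complement f_inj.
rewrite (ptrace_quad_form hK hVK hf hC e (purifiedE chiE T)).
by do 3!(apply: sumr_ge0 => ? _); apply: mul_conjC_ge0.
Qed.

Lemma ptrace_coherent_psd rho : (0 < k)%N -> psdmx rho ->
  psdmx (ptrace f (coherent_protocol rho)).
Proof.
move=> k_gt0 /psdmx_factor[T <-] e; rewrite ptrace_coherent_quad_form //.
do 3!(apply: sumr_ge0 => ? _).
by rewrite mulr_ge0 // divr_ge0 ?ler0n ?exprn_ge0 // norm2_ge0.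
Qed.

Lemma ptrace_coherent_dominance rho : (0 < k)%N -> (k * d ^ 2 <= m)%N -> psdmx rho ->
  psdmx (ptrace f (coherent_protocol rho) -
         (1 - (k * d ^ 2)%:R / m%:R) *: ptrace f (Phi rho)).
Proof.
move=> k_gt0 kd /psdmx_factor[T <-] e.
have [l [h [hV [hK hVK mkl hf hC]]]] := injection_complement f_inj.
rewrite mulmxBr mulmxBl mxE [X in _ + X]mxE -scalemxAr -scalemxAl [X in _ - X]mxE.
rewrite subr_ge0 (ptrace_quad_form hK hVK hf hC e (purifiedE chiE T)).
rewrite ptrace_coherent_quad_form // mulr_sumr; apply: ler_sum => bc _.
rewrite mulr_sumr; apply: ler_sum => eta _.
have := coherent_dominance w_ge0 design hK hVK k_gt0 mkl (leqnn m) (slice e eta)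
  (purified_inv chi_inv T bc).
by rewrite card_prod card_ord mulnn => /(_ kd).
Qed.

End Reduced.
End CoherentProtocol.

Theorem theorem1 (R : realType) (n d m : nat) (m_ge1 : (1 <= m)%N)
  (C : {linear 'M[R[i]]_n -> 'M[R[i]]_(tdim d m)})
  (C_op : quantum_operation C) (C_inv : perm_invariant_output C) :
  exists Ct : {linear 'M[R[i]]_n -> 'M[R[i]]_(tdim d m)},
    [/\ pm_protocol Ct,
        (forall rho : 'M[R[i]]_n, density rho -> \tr (Ct rho) = \tr (C rho)) &
        forall (k : nat) (rho : 'M[R[i]]_n) (f : 'I_k -> 'I_m),
          (1 <= k <= m)%N -> density rho -> 0 < success_prob C rho ->
          injective f ->
          p_err f C Ct rho >=
            2^-1 - (k%:R * d%:R ^+ 2) / (2 * m%:R * success_prob C rho)].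
Proof.
have [C_cp C_le1] := C_op.
have [chi [chi_inv chiE]] := symmetric_purification C_cp C_inv.
have [Y [w [z [w_ge0 design]]]] := @gaussian_design R[i] ('I_d * 'I_d)%type m.
have trE := coherent_protocol_trace m_ge1 chi_inv chiE design.
exists (coherent_protocol chi w z); split=> [|rho [rho_psd _]|k rho f].
- exact: (coherent_protocol_pm m_ge1 C_le1 chi_inv chiE w_ge0 design).
- exact: trE.
move=> /andP[k_gt0 _] [rho_psd rho_tr] P_gt0 f_inj.
set P := success_prob C rho in P_gt0 *.
have trC : \tr (C rho) = P%:C%C.
  have : 0 <= \tr (C rho).
    have [T TT] := psdmx_factor rho_psd.
    rewrite -TT (purified_trace chiE); do 2!(apply: sumr_ge0 => ? _).
    exact: mul_conjC_ge0.
  by rewrite /P /success_prob lecE; case: (\tr _) => a b /= /andP[/eqP -> _].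
have P_le1 : P <= 1.
  by have := C_le1 _ rho_psd; rewrite trC rho_tr lecE => /andP[].
have PV_ge0 : 0 <= (P%:C%C)^-1 by rewrite invr_ge0 lecR ltW.
have C_density : density (conditional_state f C rho).
  split; first by apply: psdmx_scale; rewrite ?trC //; apply: (ptrace_psd chiE f_inj).
  have [l [h [hV [hK hVK _ hf hC]]]] := injection_complement f_inj.
  rewrite mxtraceZ (ptrace_trace hK hVK hf hC) mulVf // trC.
  by rewrite gt_eqF // ltcR.
have m_gt0 : 0 < m%:R :> R by rewrite ltr0n.
set a : R := k%:R * d%:R ^+ 2.
have a_ge0 : 0 <= a by rewrite mulr_ge0 ?exprn_ge0 ?ler0n.
have aE : (k * d ^ 2)%:R = a by rewrite natrM natrX.
have [kd|kd] := leqP (k * d ^ 2) m.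
  apply: le_trans (min_error_prob_ge (c := 1 - a / m%:R) C_density _ _).
  - have -> : (1 - a / m%:R) / 2 = 2^-1 - a / (2 * m%:R) by field; rewrite gt_eqF.
    (* Since P <= 1, removing P from the denominator only raises the bound. *)
    rewrite lerD2l lerN2 ler_wpM2l // lef_pV2 ?posrE ?mulr_gt0 //.
    by rewrite ger_pMr ?mulr_gt0.
  - by rewrite gerBl divr_ge0.
  (* Equal success probabilities give both conditional states the same normalisation, so domination
     of the unnormalised outputs suffices. *)
  rewrite /conditional_state trE // scalerA mulrC -scalerA -scalerBr trC.
  apply: psdmx_scale => //.
  have -> : (1 - a / m%:R)%:C%C = 1 - (k * d ^ 2)%:R / m%:R :> R[i].
    by rewrite -aE rmorphB rmorph1 fmorph_div !rmorph_nat.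
  exact: (ptrace_coherent_dominance m_ge1 chi_inv chiE w_ge0 design).
(* Here k d^2 > m >= m P, so the claimed bound is at most 0 and c = 0 is enough. *)
apply: le_trans (min_error_prob_ge (c := 0) C_density _ _) => //.
  rewrite mul0r subr_le0 ler_pdivlMr ?mulr_gt0 // -!mulrA mulKf //.
  apply: (@le_trans _ _ m%:R); first by rewrite ger_pMr.
  by rewrite -aE ler_nat ltnW.
rewrite scale0r subr0 /conditional_state trE // trC; apply: psdmx_scale => //.
exact: ptrace_coherent_psd.
Qed.
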